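(* Let $K$ be the kernel on $\mathbb{R}^3\setminus\{0\}$ of a POL $T$ for a massive scalar boson. Suppose that (i) $\lim_{\lambda\to\infty}K(k,\lambda p)$ exists for every $k\neq 0$ and almost all $p$; (ii) $\lim_{\lambda,\lambda'\to\infty}K(\lambda p,\lambda'p)=1$ for almost all $p$; (iii) there is $k_0\neq 0$ such that for any sequence $\lambda_n\to\infty$ it is not the case that $K(k_0,\lambda_np)\to0$ for almost all $p$. Then $T$ is separated, i.e. $\|T(B)\|=1$ for every nonempty open ball $B\subset\mathbb{R}^3$.
   Context: The massive scalar boson is described on $L^2(\mathbb{R}^3)$ (momentum space), on which $\tilde{\mathcal E}=ISU(2)$, the covering group of the Euclidean group, acts by $(U^{(0)}(b,B)\phi)(p)=e^{-ibp}\phi(B^{-1}\cdot p)$. A POL is a normalized positive operator valued measure $T$ on the Borel sets of $\mathbb{R}^3$ ($T(\mathbb{R}^3)=I$), with values in operators on $L^2(\mathbb{R}^3)$, satisfying $U^{(0)}(g)T(\Delta)U^{(0)}(g)^{-1}=T(g\cdot\Delta)$ for all $g\in\tilde{\mathcal E}$. A kernel of $T$ is a function $K:(\mathbb{R}^3\setminus\{0\})^2\to\mathbb{C}$ which is measurable, positive definite with separable reproducing kernel Hilbert space, rotation invariant ($K(Rk,Rp)=K(k,p)$ for rotations $R$) and normalized ($K(p,p)=1$ for all $p$), such that for $\phi\in L^1\cap L^2$ and measurable $\Delta\subset\mathbb{R}^3$ $$\langle\phi,T(\Delta)\phi\rangle=(2\pi)^{-3}\int_\Delta\int\int K(k,p)e^{i(p-k)x}\overline{\phi(k)}\phi(p)\,d^3k\,d^3p\,d^3x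 .$$ Every POL has such a kernel. *)

(* Defs.v *)
(* MathComp-Analysis over an abstract [R : realType]; complex numbers are [R[i]]. *)
From HB Require Import structures.
From mathcomp Require Import all_boot all_order all_algebra.
From mathcomp Require Import complex.
From mathcomp Require Import all_classical all_reals all_analysis.
Set Implicit Arguments.
Unset Strict Implicit.
Unset Printing Implicit Defensive.
Import Order.TTheory GRing.Theory Num.Theory.
Import numFieldNormedType.Exports.

Local Open Scope classical_set_scope.
Local Open Scope ring_scope.
Local Open Scope complex_scope.
Local Open Scope sesquilinear_scope.

(* Points are ((p1, p2), p3); the sigma-algebra is the threefold product of the
   Borel sigma-algebra of R, i.e. the Borel sets of R^3.  The topology and norm
   that the library puts on a product type come from the sup norm, so the
   Euclidean structure below is spelled out with [dot]. *)
Notation R3 R :=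
  (measurableTypeR R * measurableTypeR R * measurableTypeR R)%type.

Definition mu3 (R : realType) :=
  ((@lebesgue_measure R \x @lebesgue_measure R) \x @lebesgue_measure R)%E.
Arguments mu3 {R}.

Section Euclidean.
Variable R : realType.

Definition coord (p : R3 R) (i : 'I_3) : R := nth 0 [:: p.1.1; p.1.2; p.2] i.

Definition dot (p q : R3 R) : R := \sum_(i < 3) coord p i * coord q i.

Definition euclidean_ball (a : R3 R) (r : R) : set (R3 R) :=
  [set x | dot (x - a) (x - a) < r ^+ 2].

Definition mxact (M : 'M[R]_3) (p : R3 R) : R3 R :=
  let c i := \sum_(j < 3) M i j * coord p j in (c 0, c 1, c 2%:R).

Definition SO3 (M : 'M[R]_3) : Prop := M *m M^T = 1%:M /\ \det M = 1.

Definition SU2 (B : 'M[R[i]]_2) : Prop := B \is unitarymx /\ \det B = 1.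

(* p . sigma, with sigma the vector of Pauli matrices *)
Definition pauli (p : R3 R) : 'M[R[i]]_2 :=
  \matrix_(i < 2, j < 2)
    if i == 0 then (if j == 0 then p.2%:C else p.1.1 -i* p.1.2)
    else (if j == 0 then p.1.1 +i* p.1.2 else (- p.2)%:C).

(* The covering SU(2) -> SO(3): B.p is the vector determined by
   (B.p).sigma = B (p.sigma) B^*. *)
Definition su2act (B : 'M[R[i]]_2) (p : R3 R) : R3 R :=
  let X := B *m pauli p *m B ^t* in
  (complex.Re (X 1 0), complex.Im (X 1 0), complex.Re (X 0 0)).

(* the action of (b, B) in ISU(2) on R^3 *)
Definition eucl_act (b : R3 R) (B : 'M[R[i]]_2) (x : R3 R) : R3 R :=
  b + su2act B x.

Definition punctured : set (R3 R) := [set p | p != 0].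

End Euclidean.
Arguments punctured {R}.

Section ComplexL2.
Variable R : realType.
Implicit Types (f g phi psi : R3 R -> R[i]) (D Delta : set (R3 R)).

(* e^{i t} *)
Definition expi (t : R) : R[i] := cos t +i* sin t.

Definition Cmeasurable_fun d (T : measurableType d) (D : set T)
    (f : T -> R[i]) : Prop :=
  measurable_fun D (fun x => complex.Re (f x)) /\
  measurable_fun D (fun x => complex.Im (f x)).

Definition Cintegrable D f : Prop :=
  mu3.-integrable D (fun x => (complex.Re (f x))%:E) /\
  mu3.-integrable D (fun x => (complex.Im (f x))%:E).

Definition Cint D f : R[i] :=
  (\int[mu3]_(x in D) complex.Re (f x)) +i*
  (\int[mu3]_(x in D) complex.Im (f x)).

Definition Lp (q : \bar R) f : Prop :=
  Cmeasurable_fun setT f /\ finite_norm mu3 q (fun x => Normc.normc (f x)).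

Definition L2 := Lp 2%:E.

Definition L2norm f : \bar R := Lnorm mu3 2%:E (fun x => (Normc.normc (f x))%:E).

(* linear in the second argument *)
Definition inner phi psi : R[i] := Cint setT (fun p => conjc (phi p) * psi p).

(* The elements of L^2(R^3) are handled through representatives: they are
   functions satisfying [L2], identified when [aeeq]; an operator on L^2 is a
   map on functions compatible with this identification. *)
Definition aeeq f g : Prop := {ae mu3, forall p, f p = g p}.

Definition opnorm (A : (R3 R -> R[i]) -> (R3 R -> R[i])) : \bar R :=
  ereal_sup [set L2norm (A f) | f in [set f | L2 f /\ (L2norm f <= 1%:E)%E]].

Record bounded_operator (A : (R3 R -> R[i]) -> (R3 R -> R[i])) : Prop := {
  op_L2 : forall f, L2 f -> L2 (A f);
  op_aeeq : forall f g, L2 f -> L2 g -> aeeq f g -> aeeq (A f) (A g);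
  op_linear : forall (c : R[i]) f g, L2 f -> L2 g ->
    aeeq (A (fun p => c * f p + g p)) (fun p => c * A f p + A g p);
  op_bounded : (opnorm A < +oo)%E }.

Definition positive_operator (A : (R3 R -> R[i]) -> (R3 R -> R[i])) : Prop :=
  forall f, L2 f -> 0 <= inner f (A f).

Definition U0 (b : R3 R) (B : 'M[R[i]]_2) phi : R3 R -> R[i] :=
  fun p => expi (- dot b p) * phi (su2act (invmx B) p).

(* U0 (b,B)^-1 = U0 ((b,B)^-1), where (b,B)^-1 = (- B^-1.b, B^-1) in ISU(2) *)
Definition U0inv (b : R3 R) (B : 'M[R[i]]_2) phi : R3 R -> R[i] :=
  U0 (- su2act (invmx B) b) (invmx B) phi.

(* Only the values of T on measurable sets matter. Sigma-additivity is stated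
   in the weak operator topology. *)
Record POL (T : set (R3 R) -> (R3 R -> R[i]) -> (R3 R -> R[i])) : Prop := {
  pol_bounded : forall Delta, measurable Delta -> bounded_operator (T Delta);
  pol_positive : forall Delta, measurable Delta -> positive_operator (T Delta);
  pol_sigma_additive : forall Delta_ : nat -> set (R3 R),
    (forall n, measurable (Delta_ n)) -> trivIset setT Delta_ ->
    forall phi psi, L2 phi -> L2 psi ->
    (\sum_(i < n) inner phi (T (Delta_ i) psi)) @[n --> \oo] -->
      (inner phi (T (\bigcup_n Delta_ n) psi) : R[i]^o);
  pol_normalized : forall phi, L2 phi -> aeeq (T setT phi) phi;
  pol_covariant : forall b B, SU2 B ->
    forall Delta, measurable Delta -> forall phi, L2 phi ->
    aeeq (U0 b B (T Delta (U0inv b B phi))) (T (eucl_act b B @` Delta) phi) }.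

Definition separated_POL (T : set (R3 R) -> (R3 R -> R[i]) -> (R3 R -> R[i])) :
    Prop :=
  forall (a : R3 R) (r : R), 0 < r -> opnorm (T (euclidean_ball a r)) = 1%:E.

End ComplexL2.

Section Kernels.
Variables (R : realType) (X : Type).
Implicit Types (K : X -> X -> R[i]) (H : set (X -> R[i])) (f g : X -> R[i]).
Implicit Types ip : (X -> R[i]) -> (X -> R[i]) -> R[i].

Definition positive_definite K : Prop :=
  forall (n : nat) (c : 'I_n -> R[i]) (x : 'I_n -> X),
  0 <= \sum_(i < n) \sum_(j < n) conjc (c i) * c j * K (x i) (x j).

Definition ipdist ip f g : R :=
  let h := fun x => f x - g x in Num.sqrt (complex.Re (ip h h)).

(* H with inner product ip (linear in the second argument) is a Hilbert space
   of functions on X; ip is only relevant on H. *)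
Record hilbert_function_space H ip : Prop := {
  hfs_zero : H (fun=> 0);
  hfs_lin : forall (c : R[i]) f g, H f -> H g -> H (fun x => c * f x + g x);
  hfs_ip_lin : forall (c : R[i]) f g h, H f -> H g -> H h ->
    ip h (fun x => c * f x + g x) = c * ip h f + ip h g;
  hfs_ip_conj : forall f g, H f -> H g -> ip g f = conjc (ip f g);
  hfs_ip_ge0 : forall f, H f -> 0 <= ip f f;
  hfs_ip_eq0 : forall f, H f -> ip f f = 0 -> f = (fun=> 0);
  hfs_complete : forall f_ : nat -> X -> R[i], (forall n, H (f_ n)) ->
    (forall e : R, 0 < e -> exists N : nat, forall m n : nat,
       (N <= m)%N -> (N <= n)%N -> ipdist ip (f_ m) (f_ n) < e) ->
    exists2 f, H f & ipdist ip (f_ n) f @[n --> \oo] --> (0 : R) }.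

Record reproducing_kernel_hilbert_space K H ip : Prop := {
  rkhs_hilbert : hilbert_function_space H ip;
  rkhs_section : forall p, H (fun k => K k p);
  rkhs_reproducing : forall f p, H f -> ip (fun k => K k p) f = f p }.

Definition separable_space H ip : Prop :=
  exists S : set (X -> R[i]), [/\ countable S, S `<=` H &
    forall f (e : R), H f -> 0 < e -> exists2 s, S s & ipdist ip f s < e].

(* The reproducing kernel Hilbert space of K is unique. *)
Definition separable_rkhs K : Prop :=
  exists H ip, reproducing_kernel_hilbert_space K H ip /\ separable_space H ip.

End Kernels.

Section KernelOfPOL.
Variable R : realType.

(* A function on the square of R^3 \ {0} is represented by a function on the
   square of R^3 whose values at pairs with a zero component are irrelevant. *)
Definition restrict_punctured (K : R3 R -> R3 R -> R[i]) :
    {p : R3 R | p != 0} -> {p : R3 R | p != 0} -> R[i] :=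
  fun k p => K (val k) (val p).

(* The momentum integrals run over R^3 \ {0}, where K lives. *)
Definition kernel_density (K : R3 R -> R3 R -> R[i]) (phi : R3 R -> R[i])
    (x : R3 R) : R[i] :=
  Cint punctured (fun p => Cint punctured (fun k =>
    K k p * expi (dot (p - k) x) * conjc (phi k) * phi p)).

Record kernel_of (K : R3 R -> R3 R -> R[i])
    (T : set (R3 R) -> (R3 R -> R[i]) -> (R3 R -> R[i])) : Prop := {
  kernel_measurable :
    Cmeasurable_fun (punctured `*` punctured) (fun kp => K kp.1 kp.2);
  kernel_pd : positive_definite (restrict_punctured K);
  kernel_separable : separable_rkhs (restrict_punctured K);
  kernel_rotation : forall M, SO3 M -> forall k p, k != 0 -> p != 0 ->
    K (mxact M k) (mxact M p) = K k p;
  kernel_normalized : forall p, p != 0 -> K p p = 1;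
  kernel_represents : forall phi, Lp 1%:E phi -> L2 phi ->
    forall Delta, measurable Delta ->
    Cintegrable Delta (kernel_density K phi) /\
    inner phi (T Delta phi) =
      ((2 * pi) ^- 3)%:C * Cint Delta (kernel_density K phi) }.

End KernelOfPOL.

(* Main.v *)
(* Write K(k,p) = <J_k, J_p> with unit vectors J_p in a separable Hilbert space.
   Hypothesis (ii) and rotation invariance say that J is Cauchy along rays,
   uniformly over the directions.  On a circle of momenta, separability and
   Steinhaus's theorem make J continuous, so that Re K is arbitrarily close to 1
   on far away cubes Q, whatever their size, that are seen from the origin under
   a small enough angle.

   For a wave packet phi = c 1_Q(p) e^{-i a.p} let f >= 0 be the density of
   Delta |-> <phi, T(Delta) phi>.  With m(x) = prod_j exp (- s |x_j - a_j|), the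
   integral of m f is, by Fubini, that of c^2 1_Q(k) 1_Q(p) K(k,p) W(p - k),
   where the Fourier transform W of m is a product of Poisson kernels.  As
   Re K ~ 1 on Q and W is concentrated on the scale s, this tends to (2 pi)^3 as
   Q grows.  For s large, m is negligible outside the ball of radius r around a,
   hence <phi, T(B_r(a)) phi> is close to 1 = <phi, phi>. *)
Require Import Defs.
From HB Require Import structures.
From mathcomp Require Import all_boot all_order all_algebra.
From mathcomp Require Import complex.
From mathcomp Require Import all_classical all_reals all_analysis.
From mathcomp Require Import measurable_realfun ring lra.
Import Order.TTheory GRing.Theory Num.Theory.
Import numFieldNormedType.Exports.
Local Open Scope classical_set_scope.
Local Open Scope ring_scope.

(** * The Fourier transform of exp (- s |t|) *)

(** The angle that Steinhaus's theorem yields depends on the radius of the circle, so continuity on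
    each circle is not uniform for far momenta. Therefore one radius is fixed beyond which J is
    nearly constant along rays; every far point is moved along its ray to that radius, and only
    there are directions compared. Hence the aperture of the cone depends on the tolerance alone and
    leaves room for cubes of any size. This dictates the order of the choices: s from r and the
    tolerance, the side of Q from s, and the position of Q last. The sign of f is known only through
    its integrals over Borel sets; with 0 <= m <= 1 this is enough to compare the integral of m f
    with that of f over the ball. The exponential profile of m gives W an elementary primitive, the
    arctangent, so the mass of W on Q is bounded below by explicit inequalities, coordinate by
    coordinate. An expectation close to 1 bounds the norm of T(B) from below; the upper bound comes
    from positivity of T on B and on its complement, whose values add up to the identity. *)

Section expabs.
Variable R : realType.
Implicit Types s h c a t : R.
Local Notation mu := (@lebesgue_measure R).

(** The second summand is the real part of e^((-s + ih)t + ic) / (-s + ih), the primitive of the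
    oscillating term. *)
Let F s h c t : R := - (expR (- (s * t)) / s) +
  expR (- (s * t)) * (h * sin (h * t + c) - s * cos (h * t + c)) / (s ^+ 2 + h ^+
    2).

Let sh_neq0 s h : 0 < s -> s ^+ 2 + h ^+ 2 != 0.
Proof. by move=> s0; rewrite gt_eqF// ltr_wpDr ?sqr_ge0// exprn_gt0. Qed.

Let is_derive_F s h c t : 0 < s ->
  is_derive t (1:R) (F s h c) (expR (- (s * t)) * (1 + cos (h * t + c))).
Proof.
move=> s0; have sh0 := sh_neq0 s h s0.
rewrite /F; apply: is_derive_eq.
rewrite /GRing.scale/=.
field.
by rewrite sh0 gt_eqF.
Qed.

Let F_cvg s h c : 0 < s -> F s h c t @[t --> +oo] --> (0:R).
Proof.
move=> s0.
have e0 : expR (- (s * t)) @[t --> +oo] --> (0:R).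
  apply: (@cvg_comp _ _ _ (fun t => s * t) (fun t => expR (- t)) _ (pinfty_nbhs
    R)); last exact: cvgr_expR.
  by apply: gt0_cvgMry => //; exact: cvg_id.
pose C := s^-1 + (`|h| + s) / (s ^+ 2 + h ^+ 2).
have C0 : C * expR (- (s * t)) @[t --> +oo] --> (0:R).
  by rewrite -[X in _ --> X](mulr0 C); apply: cvgMr.
have sh0 : 0 < s ^+ 2 + h ^+ 2 by rewrite ltr_wpDr ?sqr_ge0// exprn_gt0.
have b t : `|F s h c t| <= C * expR (- (s * t)).
  rewrite /F /C mulrDl (le_trans (ler_normD _ _))// lerD//.
    by rewrite normrN ger0_norm 1?mulrC// mulr_ge0 ?expR_ge0// invr_ge0 ltW.
  rewrite !normrM (ger0_norm (expR_ge0 _)) normfV (ger0_norm (ltW sh0)).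
  rewrite -mulrA mulrC ler_pM2r ?expR_gt0// ler_pM2r ?invr_gt0//.
  rewrite (le_trans (ler_normB _ _))// lerD// normrM.
    by rewrite ler_piMr// ler_norml sin_geN1 sin_le1.
  by rewrite (gtr0_norm s0); apply: ler_piMr;
    [exact: ltW|rewrite ler_norml cos_geN1 cos_le1].
apply: (squeeze_cvgr (f := fun t => - (C * expR (- (s * t)))) (h := fun t => C *
  expR (- (s * t)))) => //.
  by apply: nearW => t; rewrite -ler_norml.
by rewrite -[X in _ --> X]oppr0; apply: cvgN.
Qed.

Let half s h c : 0 < s ->
  (\int[mu]_(t in `[0%R, +oo[) (expR (- (s * t)) * (1 + cos (h * t + c)))%:E =
   (s^-1 + (s * cos c - h * sin c) / (s ^+ 2 + h ^+ 2))%:E)%E.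
Proof.
move=> s0; have sh0 := sh_neq0 s h s0.
have dF t : derivable (F s h c) t 1 by apply: ex_derive; apply: is_derive_F.
have cF : continuous (F s h c).
  by move=> t; apply: differentiable_continuous; apply/derivable1_diffP.
have cf : continuous (fun t => expR (- (s * t)) * (1 + cos (h * t + c))).
  move=> t; apply: differentiable_continuous; apply/derivable1_diffP.
  by apply: ex_derive.
rewrite (@ge0_continuous_FTC2y R (fun t => expR (- (s * t)) * (1 + cos (h * t +
  c))) (F s h c) 0 0).
- by rewrite -EFinB /F !mulr0 oppr0 expR0 !add0r; congr EFin; field;
  rewrite sh0 gt_eqF.
- by move=> t _; rewrite mulr_ge0 ?expR_ge0// -lerBlDl sub0r cos_geN1.
- exact: continuous_subspaceT.
- exact: F_cvg.
- by [].
- by apply: cvg_at_right_filter; exact: cF.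
- by move=> t _; rewrite derive1E; have [_ ->] := is_derive_F s h c t s0.
Qed.

(* Adding 1 to the cosine makes the integrand nonnegative, as the improper form of
   the fundamental theorem of calculus requires. *)
Lemma integral_expRabs_1cos s h c a : 0 < s ->
  (\int[mu]_t (expR (- (s * `|t - a|)) * (1 + cos (h * (t - a) + c)))%:E =
   (2 / s + 2 * s * cos c / (s ^+ 2 + h ^+ 2))%:E)%E.
Proof.
move=> s0; have sh0 := sh_neq0 s h s0.
pose G t := expR (- (s * `|t|)) * (1 + cos (h * t + c)).
have cG : continuous G.
  move=> t; apply: cvgM.
    apply: continuous_comp; last exact: continuous_expR.
    by apply: cvgN; apply: cvgMr; apply: cvg_norm; exact: cvg_id.
  apply: cvgD; first exact: cvg_cst.
  apply: continuous_comp; last exact: continuous_cos.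
  by apply: cvgD; [apply: cvgMr; exact: cvg_id|exact: cvg_cst].
have G0 t : 0 <= G t by rewrite mulr_ge0 ?expR_ge0// -lerBlDl sub0r cos_geN1.
have d1 : derive1 (fun t : R => t - a) = cst 1.
  apply/funext => t; rewrite derive1E.
  by have [_ ->] : is_derive t (1 : R) (fun t : R => t - a) 1 by apply:
    is_derive_eq; rewrite subr0.
transitivity (\int[mu]_t (G t)%:E)%E.
  rewrite (@increasing_ge0_integration_by_substitutionT _ (fun t => t - a) G)//.
  - by apply: eq_integral => t _; congr EFin; rewrite !fctE d1 mulr1.
  - by move=> x y xy; rewrite ltrD2r.
  - by rewrite d1; exact: cst_continuous.
  - by rewrite d1; exact: is_cvg_cst.
  - by rewrite d1; exact: is_cvg_cst.
  - by apply: (@cvg_addrr_Ny R (- a)).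
  - by apply: (@cvg_addrr R (- a)).
have mG : measurable_fun [set: R] (EFin \o G) by apply/measurable_EFinP;
  exact: continuous_measurable_fun.
(* On the negative half-line the substitution t -> -t replaces h by -h, so the two terms h sin c
   supplied by [half] cancel. *)
rewrite -(setUv `[0%R, +oo[%classic) ge0_integral_setU//=; last 4 first.
- exact: measurableC.
- by rewrite setUv.
- by move=> x _; rewrite lee_fin.
- exact/disj_setPCl.
rewrite setCitvr.
rewrite integral_itv_bndo_bndc; last exact: measurable_funTS.
rewrite -{2}oppr0 ge0_integration_by_substitutionNy//;
  last exact: continuous_subspaceT.
have -> : (\int[mu]_(x in `[0%R, +oo[) (G x)%:E = \int[mu]_(t in `[0%R, +oo[)
  (expR (- (s * t)) * (1 + cos (h * t + c)))%:E)%E.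
  apply: eq_integral => t; rewrite inE/= in_itv/= andbT => t0.
  by rewrite /G ger0_norm.
have -> : (\int[mu]_(x in `[0%R, +oo[) ((G \o -%R) x)%:E = \int[mu]_(t in `[0%R,
  +oo[) (expR (- (s * t)) * (1 + cos (- h * t + c)))%:E)%E.
  apply: eq_integral => t; rewrite inE/= in_itv/= andbT => t0.
  by rewrite /G/= normrN ger0_norm// mulrN mulNr.
rewrite !half// -EFinD; congr EFin; field.
by rewrite sh0 gt_eqF.
Qed.

Lemma integral_expRabs s a : 0 < s ->
  (\int[mu]_t (expR (- (s * `|t - a|)))%:E = (2 / s)%:E)%E.
Proof.
(* With h = 0 and c = pi / 2 the cosine vanishes identically. *)
move=> s0; have := integral_expRabs_1cos s 0 (pi / 2) a s0.
rewrite cos_pihalf mulr0 mul0r addr0 => <-.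
by apply: eq_integral => t _; rewrite mul0r add0r cos_pihalf addr0 mulr1.
Qed.

Let continuous_expRabs s a : continuous (fun t : R => expR (- (s * `|t - a|))).
Proof.
move=> t; apply: continuous_comp; last exact: continuous_expR.
apply: cvgN; apply: cvgMr; apply: cvg_norm; apply: cvgB;
  [exact: cvg_id|exact: cvg_cst].
Qed.

Lemma measurable_expRabs s a :
  measurable_fun [set: R] (fun t : R => expR (- (s * `|t - a|))).
Proof. by apply: continuous_measurable_fun; exact: continuous_expRabs. Qed.

Lemma measurable_expRabs_cos s h c a :
  measurable_fun [set: R] (fun t : R => expR (- (s * `|t - a|)) * cos (h * (t -
    a) + c)).
Proof.
apply: continuous_measurable_fun => t; apply: cvgM.
  exact: continuous_expRabs.
apply: continuous_comp; last exact: continuous_cos.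
apply: cvgD; last exact: cvg_cst.
by apply: cvgMr; apply: cvgB; [exact: cvg_id|exact: cvg_cst].
Qed.

Lemma integrable_expRabs s a : 0 < s ->
  mu.-integrable setT (fun t => (expR (- (s * `|t - a|)))%:E).
Proof.
move=> s0; apply/integrableP; split.
  by apply/measurable_EFinP; exact: measurable_expRabs.
under eq_integral do rewrite gee0_abs ?lee_fin ?expR_ge0//.
by rewrite integral_expRabs// ltry.
Qed.

Lemma integrable_expRabs_cos s h c a : 0 < s ->
  mu.-integrable setT (fun t => (expR (- (s * `|t - a|)) * cos (h * (t - a) +
    c))%:E).
Proof.
move=> s0; apply: (le_integrable _ _ _ (integrable_expRabs s a s0)) => //.
  by apply/measurable_EFinP; exact: measurable_expRabs_cos.
move=> t _; rewrite lee_fin normrM (ger0_norm (expR_ge0 _)) ler_piMr ?expR_ge0//.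
by rewrite ler_norml cos_geN1 cos_le1.
Qed.

(** The odd part of the cosine integrates to 0, which leaves the factor cos c. The free phase c
    serves twice: it absorbs the other coordinates when integrals are iterated, and c = - pi / 2
    gives the sine transform. *)
Lemma Rintegral_expRabs_cos s h c a : 0 < s ->
  \int[mu]_t (expR (- (s * `|t - a|)) * cos (h * (t - a) + c)) =
  cos c * (2 * s / (s ^+ 2 + h ^+ 2)).
Proof.
move=> s0; have := integral_expRabs_1cos s h c a s0.
move=> /(congr1 fine) /=.
rewrite -/(Rintegral mu setT _).
under eq_Rintegral do rewrite mulrDr mulr1.
rewrite RintegralD//; [|exact: integrable_expRabs|exact: integrable_expRabs_cos].
by rewrite {1}/Rintegral integral_expRabs//= => /addrI ->;
  rewrite mulrAC mulrC -mulrA mulrA mulrAC.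
Qed.

Lemma Rintegral_poisson s p u v : 0 < s -> u < v ->
  \int[mu]_(k in `[u, v]) (2 * s / (s ^+ 2 + (p - k) ^+ 2)) =
  2 * (atan ((v - p) / s) - atan ((u - p) / s)).
Proof.
move=> s0 uv.
have sn0 : s != 0 by rewrite gt_eqF.
have dG (k : R) : is_derive k (1:R) (fun k => 2 * atan ((k - p) / s)) (2 * s / (s
  ^+ 2 + (p - k) ^+ 2)).
  apply: is_derive_eq; rewrite /GRing.scale/=.
  have := sh_neq0 s (p - k) s0.
  have h2 : 1 + ((k - p) / s) ^+ 2 != 0 by rewrite gt_eqF// ltr_wpDr ?sqr_ge0.
  by move=> h1; field; rewrite sn0 h1.
have cG : continuous (fun k : R => 2 * atan ((k - p) / s)).
  move=> k; apply: differentiable_continuous; apply/derivable1_diffP.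
  by apply: ex_derive; exact: dG.
rewrite /Rintegral (@continuous_FTC2 _ _ (fun k => 2 * atan ((k - p) / s)))//.
- by rewrite -EFinB /= mulrBr.
- apply: continuous_subspaceT => k; apply: differentiable_continuous;
  apply/derivable1_diffP.
  have h1 := sh_neq0 s (p - k) s0.
  by apply: derivableM => //; apply: derivableV.
- split.
  + by move=> k _; apply: ex_derive; exact: dG.
  + by apply: cvg_at_right_filter; exact: cG.
  + by apply: cvg_at_left_filter; exact: cG.
- by move=> k _; rewrite derive1E; have [_ ->] := dG k.
Qed.
End expabs.

(** * Steinhaus's theorem on the line *)

Section steinhaus.
Variable R : realType.
Local Notation mu := (@lebesgue_measure R).

Let measurable_shift (h : R) :
  measurable_fun [set: measurableTypeR R] ((fun x => x + h) : measurableTypeR R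
    -> measurableTypeR R).
Proof.
by apply: continuous_measurable_fun => x; apply: cvgD;
  [exact: cvg_id|exact: cvg_cst].
Qed.

(** The image measure under a translation agrees with Lebesgue measure on half-open intervals, and
    these determine it. *)
Lemma lebesgue_measure_shift (A : set R) (h : R) : measurable A ->
  mu [set x | A (x + h)] = mu A.
Proof.
move=> mA; symmetry.
have mf := measurable_shift h.
pose f := MeasurableFun.Pack (MeasurableFun.Class (isMeasurableFun.Build _ _ _ _
  _ mf)).
apply: (@lebesgue_measure_unique R (pushforward mu f)) => //.
move=> X /ocitvP [->|[[a b] /= ab ->]].
  by rewrite !measure0.
rewrite /pushforward/=.
have -> : (fun x : R => x + h) @^-1` `]a, b]%classic = `]a - h, b - h]%classic.
  by apply/seteqP; split => x /=; rewrite !in_itv/= ltrBlDr lerBrDr.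
rewrite !lebesgue_measure_itv/= !lte_fin ab ltrD2r ab -!EFinD.
by congr EFin; ring.
Qed.

(** Regularity gives a compact K inside A and an open U around K with U \ K of smaller measure than
    K. By compactness U contains the d-neighbourhood of K for some d. If K - h with |h| < d missed
    K, it would fit into U \ K, although it has the measure of K. *)
Lemma steinhaus (A : set R) : measurable A -> (0 < mu A)%E ->
  exists2 d : R, 0 < d & forall h, `|h| < d -> exists t, A t /\ A (t + h).
Proof.
move=> mA; rewrite lebesgue_regularity_inner_sup// => /ereal_sup_gt[_ [K [cK KA]
  <-] K0].
have Koo := compact_finite_measure cK.
have mK : measurable K by exact: compact_measurable.
have Kf : mu K \is a fin_num by rewrite ge0_fin_numE.
have k0 : 0 < fine (mu K) by rewrite fine_gt0// K0.
have [U [oU KU UK]] := lebesgue_regularity_outer mK Koo k0.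
have [d d0 dU] : exists2 d : R, 0 < d & forall x, K x -> ball x d `<=` U.
  have /compact_near_coveringP := cK.
  move=> /(_ R (0^'+) (fun d x => ball x d `<=` U) _).
  have H : forall x : R, K x -> \forall x' \near x & i \near 0^'+, ball x' i `<=` U.
    move=> x /KU Ux; have /nbhs_ballP[e /= e0 eU] : nbhs x U by exact:
      open_nbhs_nbhs.
    exists (ball x (e / 2), [set i | i < e / 2]).
      split => /=; first by apply: nbhsx_ballx; rewrite divr_gt0.
      by apply: nbhs_right_lt; rewrite divr_gt0.
    move=> [x' i] /= [xx' ie] y xy; apply: eU.
    apply: (ball_split xx'); exact: (le_ball (ltW ie)).
  move=> /(_ H) KK.
  have [d [/= d0 dK]] : exists d : R, 0 < d /\ (K `<=` (fun x : R => ball x d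
    `<=` U)).
    near (0:R)^'+ => d; exists d; split; [by []|near: d; exact: KK].
  by exists d => // x Kx; apply: dK.
exists d => // h hd; apply: contrapT => nex.
pose K' := [set x | K (x + h)].
have mK' : measurable K'.
  by rewrite -[K']setTI; exact: (measurable_shift h).
have : (mu K' <= mu (U `\` K))%E.
  apply: le_measure; rewrite ?inE//.
    by apply: measurableD => //; exact: open_measurable.
  move=> x K'x; split.
    by apply: (dU _ K'x); rewrite /ball/= addrAC subrr add0r.
  by move=> Kx; apply: nex; exists x; split; apply: KA.
rewrite lebesgue_measure_shift// => le.
have := le_lt_trans le UK; rewrite fineK// ltxx.
by [].
Unshelve. all: by end_near.
Qed.
End steinhaus.

Set Implicit Arguments.
Unset Strict Implicit.

(** * Geometry of a reproducing kernel *)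

Section hilbert_functions.
Local Open Scope complex_scope.
Variables (R : realType) (X : Type) (H : set (X -> R[i])).
Variable ip : (X -> R[i]) -> (X -> R[i]) -> R[i].
Hypothesis hH : hilbert_function_space H ip.
Implicit Types f g h : X -> R[i].

Lemma ip_quadratic (c : R[i]) f g : H f -> H g ->
  ip (fun x => c * g x + f x) (fun x => c * g x + f x) =
  c * conjc c * ip g g + (c * ip f g + conjc (c * ip f g)) + ip f f.
Proof.
move=> Hf Hg; have Hh := hfs_lin hH c Hg Hf.
rewrite (hfs_ip_lin hH)// (hfs_ip_conj hH Hg Hh) (hfs_ip_conj hH Hf Hh).
rewrite !(hfs_ip_lin hH)// (hfs_ip_conj hH Hf Hg) !rmorphD !rmorphM /= conjcK.
rewrite -!(hfs_ip_conj hH)//.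
ring.
Qed.

Lemma Re_ip_ge0 f : H f -> 0 <= complex.Re (ip f f).
Proof. by move=> /(hfs_ip_ge0 hH); case: (ip f f) => a b;
  rewrite lecE /= => /andP[]. Qed.

(** The inequality |c g + f|^2 >= 0 in real coordinates; special values of c give the Cauchy-Schwarz
    inequality and the bounds on the kernel. *)
Lemma Re_ip_quadratic (c : R[i]) f g : H f -> H g ->
  0 <= (complex.Re c ^+ 2 + complex.Im c ^+ 2) * complex.Re (ip g g) +
   2 * (complex.Re c * complex.Re (ip f g) - complex.Im c * complex.Im (ip f g))
     + complex.Re (ip f f).
Proof.
move=> Hf Hg; have := Re_ip_ge0 (hfs_lin hH c Hg Hf).
rewrite ip_quadratic//.
have : complex.Im (ip g g) = 0.
  by have := hfs_ip_ge0 hH Hg; case: (ip g g) => a b;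
    rewrite lecE /= => /andP[/eqP].
case: (ip g g) (ip f f) (ip f g) c => [a b] [a' b'] [u v] [x y] /= -> /=.
by congr (0 <= _); ring.
Qed.

Lemma Re_ip_cauchy f g : H f -> H g ->
  complex.Re (ip f g) <= Num.sqrt (complex.Re (ip f f)) * Num.sqrt (complex.Re
    (ip g g)).
Proof.
move=> Hf Hg; rewrite -sqrtrM ?Re_ip_ge0//.
have q t : 0 <= t ^+ 2 * complex.Re (ip g g) - 2 * t * complex.Re (ip f g) +
  complex.Re (ip f f).
  have := Re_ip_quadratic (- t)%:C Hf Hg; congr (0 <= _) => /=; ring.
have := Re_ip_ge0 Hf; have := Re_ip_ge0 Hg.
move: (complex.Re (ip g g)) (complex.Re (ip f g)) (complex.Re (ip f f)) q => b r
  a q b0 a0.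
have [r0|r0] := leP r 0; first by rewrite (le_trans r0)// sqrtr_ge0.
rewrite -(ger0_norm (ltW r0)) -sqrtr_sqr ler_sqrt ?mulr_ge0//.
move: b0; rewrite le_eqVlt => /predU1P[b0|b0].
  (* If <g, g> = 0, the quadratic form is affine in t; at this t it equals -1, a contradiction. *)
  have := q ((a + 1) / (2 * r)); rewrite -b0 mulr0 add0r.
  have -> : 2 * ((a + 1) / (2 * r)) * r = a + 1 by field; rewrite gt_eqF.
  lra.
(* The minimum of the quadratic form in t. *)
have := q (r / b).
have -> : (r / b) ^+ 2 * b - 2 * (r / b) * r + a = (a * b - r ^+ 2) / b by field;
  rewrite gt_eqF.
by rewrite pmulr_lge0 ?invr_gt0// subr_ge0.
Qed.

Lemma ipdist_triangle f g h : H f -> H g -> H h ->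
  ipdist ip f h <= ipdist ip f g + ipdist ip g h.
Proof.
move=> Hf Hg Hh.
have HB u v : H u -> H v -> H (fun x => u x - v x).
  move=> Hu Hv; have := hfs_lin hH (-1) Hv Hu.
  by congr H; apply/funext => x; rewrite mulN1r addrC.
rewrite /ipdist.
set u := fun x => f x - g x; set v := fun x => g x - h x.
have -> : (fun x => f x - h x) = (fun x => 1 * u x + v x).
  by apply/funext => x; rewrite /u /v; ring.
have Hu : H u by exact: HB. have Hv : H v by exact: HB.
rewrite ip_quadratic//.
have := Re_ip_cauchy Hv Hu; have := Re_ip_ge0 Hu; have := Re_ip_ge0 Hv.
case: (ip u u) => a a'; case: (ip v v) => b b'; case: (ip v u) => c c' /= b0 a0 abc.
rewrite -[X in _ <= X]ger0_norm ?addr_ge0 ?sqrtr_ge0// -sqrtr_sqr.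
apply: ler_wsqrtr; rewrite sqrrD !sqr_sqrtr//.
lra.
Qed.

Lemma ipdist_sym f g : H f -> H g -> ipdist ip f g = ipdist ip g f.
Proof.
move=> Hf Hg; rewrite /ipdist.
have -> : (fun x => f x - g x) = (fun x => (-1) * g x + f x).
  by apply/funext => x; ring.
have -> : (fun x => g x - f x) = (fun x => (-1) * f x + g x).
  by apply/funext => x; ring.
rewrite !ip_quadratic// (hfs_ip_conj hH Hf Hg).
congr (Num.sqrt _); case: (ip f f) (ip g g) (ip f g) => [a b] [c d] [u v] /=; ring.
Qed.
End hilbert_functions.

(** * Sections of a normalized kernel as unit vectors *)

Section rkhs.
Local Open Scope complex_scope.
Variables (R : realType) (X : Type) (K : X -> X -> R[i]) (H : set (X -> R[i])).
Variable ip : (X -> R[i]) -> (X -> R[i]) -> R[i].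
Hypothesis hK : reproducing_kernel_hilbert_space K H ip.
Hypothesis K1 : forall x, K x x = 1.
Let hH := rkhs_hilbert hK.
Let J x := fun k => K k x.

Lemma ip_section x y : ip (J x) (J y) = K x y.
Proof. exact: (rkhs_reproducing hK x (rkhs_section hK y)). Qed.

Lemma ipdist_section x y : ipdist ip (J x) (J y) = Num.sqrt (2 - 2 * complex.Re
  (K x y)).
Proof.
rewrite /ipdist.
have -> : (fun k => J x k - J y k) = (fun k => (-1) * J y k + J x k).
  by apply/funext => k; ring.
rewrite (ip_quadratic hH)//; [|exact: (rkhs_section hK)..].
by rewrite !ip_section !K1; case: (K x y) => a b /=; congr (Num.sqrt _); ring.
Qed.

Lemma kernel_Re_le1 x y : `|complex.Re (K x y)| <= 1.
Proof.
have q c := Re_ip_quadratic hH c (rkhs_section hK x) (rkhs_section hK y).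
have := q 1; have := q (-1); rewrite !ip_section !K1; case: (K x y) => a b /=.
by rewrite ler_norml => h1 h2; apply/andP; split; nra.
Qed.

Lemma kernel_Im_le1 x y : `|complex.Im (K x y)| <= 1.
Proof.
have q c := Re_ip_quadratic hH c (rkhs_section hK x) (rkhs_section hK y).
(* A factor i or -i turns the imaginary part of K x y into the mixed term. *)
have := q 'i; have := q (-'i); rewrite !ip_section !K1; case: (K x y) => a b /=.
by rewrite ler_norml => h1 h2; apply/andP; split; nra.
Qed.

(** The dense set of the Hilbert space need not contain any section. For each of its points that
    lies within e / 2 of the family, one such member is chosen; the triangle inequality makes the
    chosen ones e-dense in the family. The point [t0] is only a default for the other indices. *)
Lemma dense_sections (T : Type) (c : T -> X) (t0 : T) (e : R) :
  separable_space H ip -> 0 < e ->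
  exists u : nat -> T, forall t, exists n, ipdist ip (J (c (u n))) (J (c t)) < e.
Proof.
move=> [S [/countable_injP[f finj] SH dS]] e0.
have e20 : 0 < e / 2 by rewrite divr_gt0.
pose P n t := exists s, [/\ S s, f s = n & ipdist ip (J (c t)) s < e / 2].
have /choice[u uP] : forall n, exists t, (exists t', P n t') -> P n t.
  move=> n; have [[t Pt]|nP] := pselect (exists t', P n t'); first by exists t.
  by exists t0 => Pt; case: nP.
exists u => t; have [s Ss ts] := dS (J (c t)) (e / 2) (rkhs_section hK (c t)) e20.
have [|s' [Ss' ss' us']] := uP (f s); first by exists t, s.
have {}ss' : s' = s by apply: finj; rewrite ?inE.
exists (f s); have := ipdist_triangle hH (rkhs_section hK (c (u (f s)))) (SH _
  Ss) (rkhs_section hK (c t)).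
rewrite (ipdist_sym hH (SH _ Ss) (rkhs_section hK (c t))) => /le_lt_trans; apply.
by rewrite ss' in us'; rewrite [X in _ < X]splitr; apply: ltrD.
Qed.
End rkhs.

(** * Rotations and the kernel distance *)

Section rotations.
Local Open Scope complex_scope.
Variable R : realType.
Implicit Types (x y z a : R) (p q : R3 R).

Definition mx3 (r : seq (seq R)) : 'M[R]_3 := \matrix_(i, j) nth 0 (nth [::] r i) j.

Lemma mxact_mx3 (a b c d e f g h i x y z : R) :
  mxact (mx3 [:: [:: a; b; c]; [:: d; e; f]; [:: g; h; i]]) (x, y, z) =
  (a * x + b * y + c * z, d * x + e * y + f * z, g * x + h * y + i * z).
Proof.
rewrite /mxact !big_ord_recl !big_ord0 /Defs.coord /= !mxE /=.
by congr (_, _, _); ring.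
Qed.

Lemma SO3_mx3 (a b c d e f g h i : R) :
  a ^+ 2 + b ^+ 2 + c ^+ 2 = 1 -> d ^+ 2 + e ^+ 2 + f ^+ 2 = 1 ->
  g ^+ 2 + h ^+ 2 + i ^+ 2 = 1 ->
  a * d + b * e + c * f = 0 -> a * g + b * h + c * i = 0 -> d * g + e * h + f * i
    = 0 ->
  a * (e * i - f * h) - b * (d * i - f * g) + c * (d * h - e * g) = 1 ->
  SO3 (mx3 [:: [:: a; b; c]; [:: d; e; f]; [:: g; h; i]]).
Proof.
move=> h1 h2 h3 h4 h5 h6 h7; split.
  apply/matrixP => [[[|[|[|//]]] hi]] [[|[|[|//]]] hj];
    rewrite mxE !big_ord_recl big_ord0 !mxE /=; lra.
rewrite (expand_det_row _ ord0) !big_ord_recl big_ord0 /cofactor.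
rewrite !(expand_det_row _ ord0) !big_ord_recl !big_ord0 /cofactor !det_mx11 !mxE
  /= -[RHS]h7.
by rewrite /bump /=; ring.
Qed.

Lemma SO3_neq0 M p : SO3 M -> p != 0 -> mxact M p != 0.
Proof.
move=> [/mulmx1C MM _]; apply: contra => /eqP Mp.
pose v := \col_(j < 3) Defs.coord p j.
have Mv : M *m v = 0.
  apply/matrixP => i j; rewrite !mxE.
  under eq_bigr do rewrite mxE.
  by move: Mp => [c0 c1 c2]; case: i => [[|[|[|//]]] hi];
    [rewrite -[RHS]c0|rewrite -[RHS]c1|rewrite -[RHS]c2]; apply: eq_bigr => l _;
    congr (M _ _ * _); exact: val_inj.
have : v = 0 by rewrite -[v]mul1mx -MM -mulmxA Mv mulmx0.
move=> /matrixP v0; apply/eqP.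
have := v0 0 0; have := v0 1 0; have := v0 2%:R 0; rewrite !mxE /Defs.coord /=.
by case: p {v v0 Mv Mp} => [[x y] z] /= -> -> ->.
Qed.

Definition rot_y a := mx3 [:: [:: cos a; 0; sin a]; [:: 0; 1; 0]; [:: - sin a; 0;
  cos a]].
(** The sign is such that the third axis turns towards the second for small positive a, as [rot_y]
    turns it towards the first. Conjugation by [quarter_z] relates the two circles, so that one
    circle of momenta serves for both. *)
Definition rot_x a := mx3 [:: [:: 1; 0; 0]; [:: 0; cos a; sin a]; [:: 0; - sin a;
  cos a]].
Definition quarter_z : 'M[R]_3 := mx3 [:: [:: 0; 1; 0]; [:: -1; 0; 0]; [:: 0; 0;
  1]].

Lemma SO3_rot_y a : SO3 (rot_y a).
Proof. by have := cos2Dsin2 a => h; apply: SO3_mx3; lra. Qed.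

Lemma SO3_rot_x a : SO3 (rot_x a).
Proof. by have := cos2Dsin2 a => h; apply: SO3_mx3; lra. Qed.

Lemma SO3_quarter_z : SO3 quarter_z.
Proof. by apply: SO3_mx3; lra. Qed.

Lemma mxact_rot_y a x y z :
  mxact (rot_y a) (x, y, z) = (x * cos a + z * sin a, y, z * cos a - x * sin a).
Proof. by rewrite mxact_mx3; congr (_, _, _); ring. Qed.

Lemma mxact_rot_x a x y z :
  mxact (rot_x a) (x, y, z) = (x, y * cos a + z * sin a, z * cos a - y * sin a).
Proof. by rewrite mxact_mx3; congr (_, _, _); ring. Qed.

Lemma mxact_quarter_z x y z : mxact quarter_z (x, y, z) = (y, - x, z).
Proof. by rewrite mxact_mx3; congr (_, _, _); ring. Qed.

Lemma cos_atan_div x z : 0 < z -> cos (atan (x / z)) = z / Num.sqrt (x ^+ 2 + z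
  ^+ 2).
Proof.
move=> z0; have zn0 : z != 0 by rewrite gt_eqF.
rewrite cos_atan.
have -> : x ^+ 2 + z ^+ 2 = z ^+ 2 * (1 + (x / z) ^+ 2) by field.
rewrite sqrtrM ?sqr_ge0// sqrtr_sqr gtr0_norm// invfM mulrA mulfV// mul1r//.
Qed.

Lemma sin_atan_div x z : 0 < z -> sin (atan (x / z)) = x / Num.sqrt (x ^+ 2 + z
  ^+ 2).
Proof.
move=> z0; have zn0 : z != 0 by rewrite gt_eqF.
have c0 : cos (atan (x / z)) != 0.
  by rewrite cos_atan invr_eq0 sqrtr_eq0 -ltNge ltr_wpDr ?sqr_ge0.
have := atanK (x / z); rewrite /tan => /(canRL (mulfVK c0)) ->.
by rewrite cos_atan_div// mulrA mulfVK.
Qed.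

(** Here n is the Euclidean norm. The angles do not depend on l, so one rotation carries a whole ray
    of the third axis onto the ray through the point; small angles correspond to a narrow cone. *)
Lemma polar_decomposition x y z : 0 < z ->
  exists2 n : R, z <= n & forall l : R, l *: ((x, y, z) : R3 R) =
   mxact (rot_y (atan (x / z)))
     (mxact (rot_x (atan (y / Num.sqrt (x ^+ 2 + z ^+ 2)))) (0, 0, l * n)).
Proof.
move=> z0; set rho : R := Num.sqrt (x ^+ 2 + z ^+ 2).
have rho0 : 0 < rho by rewrite sqrtr_gt0 ltr_wpDl ?sqr_ge0// exprn_gt0.
exists (Num.sqrt (y ^+ 2 + rho ^+ 2)).
  rewrite sqr_sqrtr ?addr_ge0 ?sqr_ge0//.
  rewrite -[X in X <= _](gtr0_norm z0) -sqrtr_sqr; apply: ler_wsqrtr.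
  by rewrite addrA ler_wpDl// addr_ge0 ?sqr_ge0.
move=> l; rewrite mxact_rot_x mxact_rot_y.
rewrite !(cos_atan_div _ rho0).
rewrite !(cos_atan_div _ z0) !(sin_atan_div _ z0) -/rho !(sin_atan_div _ rho0).
set n := Num.sqrt _.
have n0 : n != 0 by rewrite gt_eqF// sqrtr_gt0 ltr_wpDl ?sqr_ge0// exprn_gt0.
have r0 : rho != 0 by rewrite gt_eqF.
rewrite [LHS](_ : _ = (l * x, l * y, l * z))//.
by congr (_, _, _); field; rewrite ?n0 ?r0.
Qed.
End rotations.
Lemma measurable_punctured (R : realType) : measurable (@punctured R).
Proof.
have -> : @punctured R = ~` ([set 0] `*` [set 0] `*` [set 0]).
  apply/seteqP; split => -[[x y] z] /=.
    by move=> p0 [[/= x0 y0] z0]; move: p0; rewrite /punctured /= x0 y0 z0 eqxx.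
  by move=> h; apply/negP => /eqP[x0 y0 z0]; apply: h.
by apply: measurableC; apply: measurableX => //; apply: measurableX.
Qed.

Lemma mu3_setX (R : realType) (A B C : set (measurableTypeR R)) :
  measurable A -> measurable B -> measurable C ->
  (mu3 (A `*` B `*` C) = lebesgue_measure A * lebesgue_measure B *
    lebesgue_measure C)%E.
Proof.
move=> mA mB mC; rewrite /mu3 product_measure1E//; last exact: measurableX.
by congr (_ * _)%E; exact: product_measure1E.
Qed.

(** * Near constancy of the kernel on far narrow cones *)

Section kernel_distance.
Local Open Scope complex_scope.
Variables (R : realType) (K : R3 R -> R3 R -> R[i]).
Hypothesis mK : Cmeasurable_fun (punctured `*` punctured) (fun kp => K kp.1 kp.2).
Hypothesis sepK : separable_rkhs (restrict_punctured K).
Hypothesis rotK : forall M, SO3 M -> forall k p, k != 0 -> p != 0 ->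
  K (mxact M k) (mxact M p) = K k p.
Hypothesis K1 : forall p, p != 0 -> K p p = 1.
Implicit Types (k p q : R3 R) (e L t : R).

(* The distance of the sections K(., p) and K(., q) in the RKHS. *)
Definition kdist p q : R := Num.sqrt (2 - 2 * complex.Re (K p q)).

Let rK1 x : restrict_punctured K x x = 1.
Proof. by case: x => p p0; exact: K1. Qed.

Lemma kdist_triangle q p r : q != 0 -> p != 0 -> r != 0 ->
  kdist p r <= kdist p q + kdist q r.
Proof.
move=> q0 p0 r0; have [H [ip [hK _]]] := sepK.
have := ipdist_triangle (rkhs_hilbert hK) (rkhs_section hK (exist _ p p0))
  (rkhs_section hK (exist _ q q0)) (rkhs_section hK (exist _ r r0)).
by rewrite !(ipdist_section hK rK1).
Qed.

Lemma kdist_sym p q : p != 0 -> q != 0 -> kdist p q = kdist q p.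
Proof.
move=> p0 q0; have [H [ip [hK _]]] := sepK.
have := ipdist_sym (rkhs_hilbert hK) (rkhs_section hK (exist _ p p0))
  (rkhs_section hK (exist _ q q0)).
by rewrite !(ipdist_section hK rK1).
Qed.

Lemma kdist_rot M p q : SO3 M -> p != 0 -> q != 0 ->
  kdist (mxact M p) (mxact M q) = kdist p q.
Proof. by move=> oM p0 q0; rewrite /kdist rotK. Qed.

Lemma kernel_Re_bound p q : p != 0 -> q != 0 -> `|complex.Re (K p q)| <= 1.
Proof.
move=> p0 q0; have [H [ip [hK _]]] := sepK.
exact: (kernel_Re_le1 hK rK1 (exist _ p p0) (exist _ q q0)).
Qed.

Lemma kernel_Im_bound p q : p != 0 -> q != 0 -> `|complex.Im (K p q)| <= 1.
Proof.
move=> p0 q0; have [H [ip [hK _]]] := sepK.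
exact: (kernel_Im_le1 hK rK1 (exist _ p p0) (exist _ q q0)).
Qed.

Lemma kdist_dense (c : R -> R3 R) e : (forall t, c t != 0) -> 0 < e ->
  exists u : nat -> R, forall t, exists n, kdist (c (u n)) (c t) < e.
Proof.
move=> c0 e0; have [H [ip [hK sep]]] := sepK.
have [u uP] := dense_sections hK (fun t => exist _ (c t) (c0 t)) 0 sep e0.
exists u => t; have [n] := uP t; rewrite (ipdist_section hK rK1) => h; exists n;
  exact: h.
Qed.

Let neq0 (a b c : R) : c != 0 -> ((a, b, c) : R3 R) != 0.
Proof. by move=> c0; apply/negP => /eqP[_ _ c00]; rewrite c00 eqxx in c0. Qed.

Definition circle (L t : R) : R3 R := (L * sin t, 0, L * cos t).

Let circle_neq0 L t : L != 0 -> circle L t != 0.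
Proof.
move=> L0; apply/negP => /eqP[/eqP + /eqP].
rewrite !mulf_eq0 (negPf L0) /= => /eqP s0 /eqP c0.
by have := cos2Dsin2 t; rewrite s0 c0 expr0n addr0 => /esym/eqP; rewrite oner_eq0.
Qed.

Let circle_rot L t h : mxact (rot_y t) (circle L h) = circle L (h + t).
Proof. by rewrite mxact_rot_y /circle sinD cosD; congr (_, _, _); ring. Qed.

Let measurable_kdist_circle L s e : L != 0 -> 0 < e ->
  measurable [set t | kdist (circle L s) (circle L t) < e].
Proof.
move=> L0 e0.
have mc : measurable_fun [set: R] (fun t => (circle L s, circle L t) : R3 R * R3 R).
  apply: measurable_fun_pair; first exact: measurable_cst.
  apply: measurable_fun_pair; first apply: measurable_fun_pair; last 2 first.
  - exact: measurable_cst.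
  - apply: continuous_measurable_fun => t; apply: cvgMr; exact: continuous_cos.
  - apply: continuous_measurable_fun => t; apply: cvgMr; exact: continuous_sin.
have mf : measurable_fun [set: R] (fun t => complex.Re (K (circle L s) (circle L
  t))).
  apply: (@measurable_comp _ _ _ _ _ _ (punctured `*` punctured) (fun kp =>
    complex.Re (K kp.1 kp.2)) setT (fun t => (circle L s, circle L t))) => //.
  - by apply: measurableX; exact: measurable_punctured.
  - by move=> _ [t _ <-]; split => /=; exact: circle_neq0.
  - exact: mK.1.
(* Squaring turns [kdist] < e into Re K > 1 - e^2 / 2, a condition on a measurable function. *)
have -> : [set t | kdist (circle L s) (circle L t) < e] =
   setT `&` (fun t => complex.Re (K (circle L s) (circle L t))) @^-1` `]1 - e ^+
     2 / 2, +oo[%classic.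
  rewrite setTI; apply/seteqP; split => t /=; rewrite in_itv/= andbT /kdist.
    move=> h; have : 2 - 2 * complex.Re (K (circle L s) (circle L t)) < e ^+ 2.
      by rewrite -ltr_sqrt ?exprn_gt0// sqrtr_sqr gtr0_norm.
    lra.
  move=> h; rewrite -[X in _ < X](gtr0_norm e0) -sqrtr_sqr ltr_sqrt ?exprn_gt0//;
    lra.
exact: mf.
Qed.

(* A countable dense subset of the circle yields a covering of the line by
   measurable sets of angles of small kdist diameter; one has positive measure,
   and Steinhaus and rotation invariance apply to it. *)
Lemma kdist_circle_small L e : L != 0 -> 0 < e ->
  exists2 d, 0 < d & forall h, `|h| < d -> kdist (circle L h) (circle L 0) < e.
Proof.
move=> L0 e0; have e20 : 0 < e / 2 by rewrite divr_gt0.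
have [u uP] := kdist_dense (fun t => circle_neq0 t L0) e20.
pose A n := [set t | kdist (circle L (u n)) (circle L t) < e / 2].
have mA n : measurable (A n) by exact: measurable_kdist_circle.
have [n An0] : exists n, (0 < @lebesgue_measure R (A n))%E.
  apply: contrapT => /forallNP A0.
  have : (@lebesgue_measure R).-negligible (\bigcup_n A n).
    apply: negligible_bigcup => n; exists (A n); split => //; first exact: mA.
    by apply/eqP; rewrite -measure_le0 leNgt; apply/negP; exact: A0.
  have -> : \bigcup_n A n = [set: R].
    by apply/seteqP; split => // t _; have [n] := uP t; exists n.
  move=> /(measure_negligible measurableT).
  have : lebesgue_measure [set: R] = +oo%E by rewrite -set_itvNyy
    lebesgue_measure_itv.
  by move=> h1 h2; have := etrans (esym h1) h2.
have [d d0 dP] := steinhaus _ _ (mA n) An0.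
exists d => // h /dP[t [At Ath]].
(* Rotation by t moves the angles h and 0 to t + h and t, which both lie in [A n], hence within e /
   2 of the angle [u n]. *)
rewrite -(kdist_rot (SO3_rot_y t)) ?circle_neq0// !circle_rot add0r [h + t]addrC.
have c0 := fun t => circle_neq0 t L0.
have := kdist_triangle (c0 (u n)) (c0 (t + h)) (c0 t).
rewrite (kdist_sym (c0 (t + h)) (c0 (u n))) => /le_lt_trans; apply.
by rewrite [X in _ < X]splitr; apply: ltrD.
Qed.

Hypothesis hii : {ae mu3, forall p : R3 R,
  K (lam.1 *: p) (lam.2 *: p)
    @[lam --> filter_prod (pinfty_nbhs R) (pinfty_nbhs R)]
    --> (1 : R[i]^o)}.

(** The cube ]0, 1]^3 has measure 1, so it is not contained in the exceptional null set. *)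
Lemma ray_point : exists2 p : R3 R, 0 < p.2 & K (lam.1 *: p) (lam.2 *: p)
    @[lam --> filter_prod (pinfty_nbhs R) (pinfty_nbhs R)]
    --> (1 : R[i]^o).
Proof.
apply: contrapT => nex.
have : mu3.-negligible (`]0, 1] `*` `]0, 1] `*` `]0, 1] : set (R3 R)).
  apply: negligibleS hii => p /= [_]; rewrite /= in_itv/= => /andP[p0 _] h.
  by apply: nex; exists p.
have m1 : measurable (`]0, 1]%classic : set (measurableTypeR R)) by exact:
  measurable_itv.
move=> /(measure_negligible (measurableX (measurableX m1 m1) m1)) E.
have := mu3_setX m1 m1 m1; rewrite [X in X = _ -> _]E.
rewrite lebesgue_measure_itv/= lte_fin ltr01 oppr0 adde0 !mul1e => /esym/eqP.
by rewrite eqe oner_eq0.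
Qed.

(** One good ray is enough: rotation invariance transports its limit to the third axis. Since the
    squared distance is 2 - 2 Re K, it suffices that |1 - K| < e^2 / 2. *)
Lemma kdist_ray_small e : 0 < e -> exists2 L, 0 < L &
  forall s t, L <= s -> L <= t -> kdist (0, 0, s) (0, 0, t) < e.
Proof.
move=> e0; have [[[x y] z] /= z0] := ray_point.
have [n zn pE] := polar_decomposition x y z0.
have n0 : 0 < n by exact: lt_le_trans zn.
have e2 : 0 < (e ^+ 2 / 2)%:C by rewrite ltcR divr_gt0// exprn_gt0.
have nb : nbhs (1 : R[i]^o) [set w : R[i]^o | `|1 - w| < (e ^+ 2 / 2)%:C].
  by exists (e ^+ 2 / 2)%:C.
move=> /(_ _ nb) [[U V] /= [[a [_ aU]] [b [_ bV]]] UV].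
pose m := Num.max `|a| `|b|.
have m0 : 0 <= m by rewrite le_max normr_ge0.
(* A point at height s on the axis has parameter s / n on the ray; this must exceed both thresholds
   a and b. *)
exists (n * (m + 1)); first by rewrite mulr_gt0// ltr_wpDl.
move=> s t Ls Lt.
have ms r : n * (m + 1) <= r -> m < r / n.
  by rewrite mulrC -ler_pdivlMr// => /(lt_le_trans _); apply; rewrite ltrDl.
have inUV : U (s / n) /\ V (t / n).
  split.
    by apply: aU; rewrite (le_lt_trans _ (ms _ Ls))// le_max ler_norm.
  by apply: bV; rewrite (le_lt_trans _ (ms _ Lt))// le_max ler_norm orbT.
have := UV (s / n, t / n); rewrite /= !pE !divfK ?gt_eqF//.
rewrite !rotK; last 6 first.
- exact: SO3_rot_x.
- by apply: neq0; rewrite gt_eqF// (lt_le_trans _ Ls)// mulr_gt0// ltr_wpDl.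
- by apply: neq0; rewrite gt_eqF// (lt_le_trans _ Lt)// mulr_gt0// ltr_wpDl.
- exact: SO3_rot_y.
- by apply: SO3_neq0; [exact: SO3_rot_x|apply: neq0;
  rewrite gt_eqF// (lt_le_trans _ Ls)// mulr_gt0// ltr_wpDl].
- by apply: SO3_neq0; [exact: SO3_rot_x|apply: neq0;
  rewrite gt_eqF// (lt_le_trans _ Lt)// mulr_gt0// ltr_wpDl].
move=> /(_ inUV); rewrite /kdist; case: (K _ _) => u v /=.
rewrite normc_def /= ltcR => h.
rewrite -[X in _ < X](gtr0_norm e0) -sqrtr_sqr ltr_sqrt ?exprn_gt0//.
have : `|1 - u| < e ^+ 2 / 2.
  apply: le_lt_trans h; rewrite -sqrtr_sqr; apply: ler_wsqrtr.
  by rewrite lerDl sqr_ge0.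
by rewrite ltr_norml => /andP[]; lra.
Qed.

(** Every point of the cone is within e / 2 of the reference point E = (0, 0, L), by three moves of
    cost e / 6: along its ray to radius L, then back through the angles b and a on circles of radius
    L. Only this radius enters the choice of [eta]. *)
Lemma kdist_cone_small e : 0 < e -> exists2 eta : R, 0 < eta & exists2 L : R, 0 <
  L &
  forall k p, L <= k.2 -> L <= p.2 ->
   `|k.1.1| <= eta * k.2 -> `|k.1.2| <= eta * k.2 ->
   `|p.1.1| <= eta * p.2 -> `|p.1.2| <= eta * p.2 -> kdist k p < e.
Proof.
move=> e0; have e60 : 0 < e / 6 by rewrite divr_gt0.
have [L L0 rayP] := kdist_ray_small e60.
have Ln0 : L != 0 by rewrite gt_eqF.
have [d d0 circP] := kdist_circle_small Ln0 e60.
have [eta eta0 atanP] : exists2 eta : R, 0 < eta & forall t, `|t| <= eta ->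
  `|atan t| < d.
  have /cvgrPdist_lt /(_ _ d0) := @continuous_atan R 0.
  move=> /nbhs_ballP[eta /= eta0 h]; exists (eta / 2); first by rewrite divr_gt0.
  move=> t te; have := h t; rewrite /ball/= atan0 !sub0r !normrN; apply.
  by rewrite (le_lt_trans te)// ltr_pdivrMr// mulr_natr mulr2n ltrDl.
exists eta => //; exists L => //.
pose E : R3 R := (0, 0, L).
have E0 : E != 0 by exact: neq0.
have key p : L <= p.2 -> `|p.1.1| <= eta * p.2 -> `|p.1.2| <= eta * p.2 ->
    p != 0 /\ kdist p E < e / 2.
  case: p => [[x y] z] /= Lz xz yz.
  have z0 : 0 < z by exact: lt_le_trans Lz.
  split; first by apply: neq0; rewrite gt_eqF.
  have [n zn /(_ 1)] := polar_decomposition x y z0.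
  rewrite scale1r mul1r => ->.
  set a := atan _; set b := atan _.
  have ad : `|a| < d by apply: atanP; rewrite normrM normfV (gtr0_norm z0)
    ler_pdivrMr.
  have bd : `|b| < d.
    have rz : z <= Num.sqrt (x ^+ 2 + z ^+ 2).
      by rewrite -[X in X <= _](gtr0_norm z0) -sqrtr_sqr; apply: ler_wsqrtr;
        rewrite lerDr sqr_ge0.
    have r0 : 0 < Num.sqrt (x ^+ 2 + z ^+ 2) by exact: lt_le_trans rz.
    apply: atanP; rewrite normrM normfV (gtr0_norm r0) ler_pdivrMr// (le_trans
      yz)//.
    by rewrite ler_wpM2l// ltW.
  have nn0 : n != 0 by rewrite gt_eqF// (lt_le_trans z0).
  have P0 : ((0, 0, n) : R3 R) != 0 by exact: neq0.
  have [Y X Z] := And3 (SO3_rot_y a) (SO3_rot_x b) (SO3_quarter_z R).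
  pose q1 := mxact (rot_y a) (mxact (rot_x b) E); pose q2 := mxact (rot_y a) E.
  have XE0 := SO3_neq0 X E0; have XP0 := SO3_neq0 X P0.
  have q10 : q1 != 0 by exact: SO3_neq0. have q20 : q2 != 0 by exact: SO3_neq0.
  have h1 : kdist (mxact (rot_y a) (mxact (rot_x b) (0, 0, n))) q1 < e / 6.
    by rewrite /q1 !kdist_rot// rayP// (le_trans Lz).
  have circE : E = circle L 0 by rewrite /circle sin0 cos0 mulr0 mulr1.
  have h2 : kdist q1 q2 < e / 6.
    (* The quarter turn fixes E and brings the circle of [rot_x] onto [circle L], where [circP]
       applies. *)
    rewrite /q1 /q2 kdist_rot// -(kdist_rot Z)//.
    rewrite mxact_rot_x !mxact_quarter_z.
    have := circP b bd; rewrite /circle sin0 cos0 !(mul0r, mulr0, mulr1, add0r,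
      oppr0, subr0).
    done.
  have h3 : kdist q2 E < e / 6.
    by have := circP a ad; rewrite /q2 circE circle_rot add0r.
  have PP0 := SO3_neq0 Y XP0.
  have t1 := kdist_triangle q10 PP0 E0.
  have t2 := kdist_triangle q20 q10 E0.
  lra.
move=> k p Lk Lp k1 k2 p1 p2.
have [k0 hk] := key k Lk k1 k2; have [p0 hp] := key p Lp p1 p2.
have := kdist_triangle E0 k0 p0; rewrite (kdist_sym E0 p0); lra.
Qed.

End kernel_distance.

(** * Fubini's theorem for real integrals *)

Section sigma_finite_product.
Context d1 d2 (T1 : measurableType d1) (T2 : measurableType d2) (R : realType).
Variable m1 : {sigma_finite_measure set T1 -> \bar R}.
Variable m2 : {sigma_finite_measure set T2 -> \bar R}.

Lemma sigma_finite_product : sigma_finite setT (m1 \x m2)%E.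
Proof.
have [F [FT Fnd Foo]] := (sigma_finiteP _ _).1 (sigma_finiteT m1).
have [G [GT Gnd Goo]] := (sigma_finiteP _ _).1 (sigma_finiteT m2).
exists (fun n => F n `*` G n).
  apply/esym/seteqP; split => // -[x y] _.
  have [n _ Fx] : (\bigcup_n F n) x by rewrite -FT.
  have [k _ Gy] : (\bigcup_n G n) y by rewrite -GT.
  (* The exhaustions are increasing, so a common index exists for both coordinates. *)
  exists (maxn n k) => //; split => /=.
    by have /subsetPset := Fnd _ _ (leq_maxl n k); exact.
  by have /subsetPset := Gnd _ _ (leq_maxr n k); exact.
move=> n; have [mF Fn] := Foo n; have [mG Gn] := Goo n.
split; first exact: measurableX.
by rewrite product_measure1E// lte_mul_pinfty// ge0_fin_numE.
Qed.

(* The library's canonical sigma-finite structure on [m1 \x m2] only covers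
   subprobability factors. *)
Definition sigma_finite_prod : {sigma_finite_measure set (T1 * T2)%type -> \bar
  R} :=
  HB.pack (m1 \x m2)%E
    (Measure_isSigmaFinite.Build _ _ _ (m1 \x m2)%E sigma_finite_product).
End sigma_finite_product.

Section real_fubini.
Context d1 d2 (T1 : measurableType d1) (T2 : measurableType d2) (R : realType).
Variable m1 : {sigma_finite_measure set T1 -> \bar R}.
Variable m2 : {sigma_finite_measure set T2 -> \bar R}.

(** An iterated [Rintegral] applies [fine] to inner integrals that may be infinite on a null set;
    this does not affect the outer integral. *)
Let fine_ae d (T : measurableType d) (m : {measure set T -> \bar R}) (F : T ->
  \bar R) :
  measurable_fun setT F -> {ae m, forall x, F x \is a fin_num} ->
  \int[m]_x fine (F x) = fine (\int[m]_x F x)%E.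
Proof.
move=> mF [N [mN N0 sN]]; rewrite /Rintegral; congr fine;
  apply: ae_eq_integral => //.
- by apply/measurable_EFinP; apply: measurableT_comp.
- exists N; split => // x nx; apply: sN => h; apply: nx => _.
  by rewrite fineK.
Qed.

Lemma Rintegral_prod12 (f : T1 * T2 -> R) : (m1 \x m2)%E.-integrable setT (EFin
  \o f) ->
  \int[m1]_x \int[m2]_y f (x, y) = \int[(m1 \x m2)%E]_z f z.
Proof.
move=> intf; transitivity (fine (\int[m1]_x fubini_F m2 (EFin \o f) x)%E).
  apply: fine_ae; first exact: measurable_fubini_F intf.
  by apply: filterS (ae_integrable1 intf) => x /(integrable_fin_num measurableT).
by rewrite integral12_prod_meas1.
Qed.

Lemma Rintegral_prod21 (f : T1 * T2 -> R) : (m1 \x m2)%E.-integrable setT (EFin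
  \o f) ->
  \int[m2]_y \int[m1]_x f (x, y) = \int[(m1 \x m2)%E]_z f z.
Proof.
move=> intf; transitivity (fine (\int[m2]_x fubini_G m1 (EFin \o f) x)%E).
  apply: fine_ae; first exact: measurable_fubini_G intf.
  by apply: filterS (ae_integrable2 intf) => x /(integrable_fin_num measurableT).
by rewrite integral21_prod_meas1.
Qed.

Lemma integrable_tensor (f : T1 -> R) (g : T2 -> R) :
  m1.-integrable setT (EFin \o f) -> m2.-integrable setT (EFin \o g) ->
  (m1 \x m2)%E.-integrable setT (EFin \o (fun z => f z.1 * g z.2)).
Proof.
move=> intf intg; apply/integrable12ltyP.
  apply/measurable_EFinP; apply: measurable_funM.
    by apply: measurableT_comp => //; apply/measurable_EFinP;
      exact: measurable_int intf.
  by apply: measurableT_comp => //; apply/measurable_EFinP;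
    exact: measurable_int intg.
rewrite (_ : (\int[m1]_x _)%E = (\int[m1]_x (`|(f x)%:E| * \int[m2]_y `|(g
  y)%:E|))%E).
  have /integrableP[mg gy] := intg; have /integrableP[mf fy] := intf.
  rewrite ge0_integralZr//.
  - by apply: lte_mul_pinfty => //; [exact: integral_ge0|rewrite ge0_fin_numE//;
    exact: integral_ge0].
  - exact: measurableT_comp.
  - exact: integral_ge0.
apply: eq_integral => x _; have /integrableP[mg gy] := intg.
rewrite -ge0_integralZl//; last exact: measurableT_comp.
by apply: eq_integral => y _ /=; rewrite normrM EFinM.
Qed.

Lemma Rintegral_tensor (f : T1 -> R) (g : T2 -> R) :
  m1.-integrable setT (EFin \o f) -> m2.-integrable setT (EFin \o g) ->
  \int[(m1 \x m2)%E]_z (f z.1 * g z.2) = (\int[m1]_x f x) * (\int[m2]_y g y).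
Proof.
move=> intf intg; rewrite -(Rintegral_prod12 (integrable_tensor intf intg))/=.
rewrite -RintegralZr//; apply: eq_Rintegral => x _.
by rewrite RintegralZl.
Qed.
End real_fubini.

Section lebesgue_powers.
Variable R : realType.
(** These carry the sigma-finiteness used by Fubini's theorem. As a measure [leb3] unfolds to [mu3];
    [leb6] is for pairs of momenta. *)
Definition leb1 : {sigma_finite_measure set (measurableTypeR R) -> \bar R} :=
  @lebesgue_measure R.
Definition leb2 := sigma_finite_prod leb1 leb1.
Definition leb3 := sigma_finite_prod leb2 leb1.
Definition leb6 := sigma_finite_prod leb3 leb3.

Lemma integrable_tensor3 (f g h : measurableTypeR R -> R) :
  leb1.-integrable setT (EFin \o f) -> leb1.-integrable setT (EFin \o g) ->
  leb1.-integrable setT (EFin \o h) ->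
  leb3.-integrable setT (EFin \o (fun x => f x.1.1 * g x.1.2 * h x.2)).
Proof.
move=> If Ig Ih.
exact: (@integrable_tensor _ _ _ _ R leb2 leb1 (fun y => f y.1 * g y.2) h
  (integrable_tensor If Ig) Ih).
Qed.

Lemma Rintegral_tensor3 (f g h : measurableTypeR R -> R) :
  leb1.-integrable setT (EFin \o f) -> leb1.-integrable setT (EFin \o g) ->
  leb1.-integrable setT (EFin \o h) ->
  \int[leb3]_x (f x.1.1 * g x.1.2 * h x.2) =
  \int[leb1]_t f t * \int[leb1]_t g t * \int[leb1]_t h t.
Proof.
move=> If Ig Ih; rewrite -(Rintegral_tensor If Ig).
exact: (@Rintegral_tensor _ _ _ _ R leb2 leb1 (fun y => f y.1 * g y.2) h
  (integrable_tensor If Ig) Ih).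
Qed.
End lebesgue_powers.

(** * Smearing the density of the localization *)

Section smearing.
Variable R : realType.
Local Notation leb1 := (leb1 R).
Local Notation leb2 := (leb2 R).
Local Notation leb3 := (leb3 R).
Implicit Types (s c : R) (a h x p k : R3 R).

Lemma dotE p k : dot p k = p.1.1 * k.1.1 + p.1.2 * k.1.2 + p.2 * k.2.
Proof. by rewrite /dot !big_ord_recl big_ord0 /Defs.coord /= addr0 addrA. Qed.

(** The weight m of the overview. The exponent is the l^1 norm, not the Euclidean one, so that m and
    its transform [poisson3] factor over the coordinates. *)
Definition expabs3 s a x : R :=
  expR (- (s * `|x.1.1 - a.1.1|)) * expR (- (s * `|x.1.2 - a.1.2|)) *
  expR (- (s * `|x.2 - a.2|)).

Definition poisson3 s h : R :=
  (2 * s / (s ^+ 2 + h.1.1 ^+ 2)) * (2 * s / (s ^+ 2 + h.1.2 ^+ 2)) *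
  (2 * s / (s ^+ 2 + h.2 ^+ 2)).

Lemma integrable_expabs3 s a : 0 < s -> leb3.-integrable setT (EFin \o expabs3 s a).
Proof.
move=> s0.
exact: (integrable_tensor3 (integrable_expRabs _ _ a.1.1 s0) (integrable_expRabs
  _ _ a.1.2 s0) (integrable_expRabs _ _ a.2 s0)).
Qed.

Lemma measurable_coord11 : measurable_fun [set: R3 R] (fun x => x.1.1 : R).
Proof. exact: (measurableT_comp measurable_fst measurable_fst). Qed.
Lemma measurable_coord12 : measurable_fun [set: R3 R] (fun x => x.1.2 : R).
Proof. exact: (measurableT_comp measurable_snd measurable_fst). Qed.
Lemma measurable_coord2 : measurable_fun [set: R3 R] (fun x => x.2 : R).
Proof. exact: measurable_snd. Qed.

Section dot_measurable.
Context d (T : measurableType d).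
Implicit Types f g : T -> R3 R.

Lemma measurable_coords f : measurable_fun setT f ->
  [/\ measurable_fun setT (fun z => (f z).1.1 : R), measurable_fun setT (fun z =>
    (f z).1.2 : R)
    & measurable_fun setT (fun z => (f z).2 : R)].
Proof.
move=> mf; split.
- exact: (measurableT_comp measurable_coord11 mf).
- exact: (measurableT_comp measurable_coord12 mf).
- exact: (measurableT_comp measurable_coord2 mf).
Qed.

Lemma measurable_dot f g : measurable_fun setT f -> measurable_fun setT g ->
  measurable_fun setT (fun z => dot (f z) (g z)).
Proof.
move=> /measurable_coords[f1 f2 f3] /measurable_coords[g1 g2 g3].
under eq_fun do rewrite dotE.
by apply: measurable_funD; [apply: measurable_funD|]; apply: measurable_funM.
Qed.

Lemma measurable_subR3 f g : measurable_fun setT f -> measurable_fun setT g ->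
  measurable_fun setT (fun z => f z - g z).
Proof.
move=> /measurable_coords[f1 f2 f3] /measurable_coords[g1 g2 g3].
apply: measurable_fun_pair; [apply: measurable_fun_pair|].
- exact: (measurable_funB f1 g1).
- exact: (measurable_funB f2 g2).
- exact: (measurable_funB f3 g3).
Qed.

Lemma measurable_cos (f : T -> R) : measurable_fun setT f -> measurable_fun setT
  (fun z => cos (f z)).
Proof. by move=> mf; apply: measurableT_comp => //;
  apply: continuous_measurable_fun; exact: continuous_cos. Qed.

Lemma measurable_sin (f : T -> R) : measurable_fun setT f -> measurable_fun setT
  (fun z => sin (f z)).
Proof. by move=> mf; apply: measurableT_comp => //;
  apply: continuous_measurable_fun; exact: continuous_sin. Qed.
End dot_measurable.

Lemma measurable_expabs3 s a : measurable_fun setT (expabs3 s a).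
Proof.
apply: measurable_funM; [apply: measurable_funM|].
- exact: (measurableT_comp (measurable_expRabs R s a.1.1) measurable_coord11).
- exact: (measurableT_comp (measurable_expRabs R s a.1.2) measurable_coord12).
- exact: (measurableT_comp (measurable_expRabs R s a.2) measurable_coord2).
Qed.

Lemma expabs3_ge0 s a x : 0 <= expabs3 s a x.
Proof. by rewrite !mulr_ge0 ?expR_ge0. Qed.

Lemma normr_cos_le1 (t : R) : `|cos t| <= 1.
Proof. by rewrite ler_norml cos_geN1 cos_le1. Qed.

Lemma integrable_expabs3_cos s a h c : 0 < s ->
  leb3.-integrable setT (EFin \o (fun x => expabs3 s a x * cos (dot h (x - a) +
    c))).
Proof.
move=> s0; apply: (le_integrable _ _ _ (integrable_expabs3 a s0)) => //.
  apply/measurable_EFinP/measurable_funM; first exact: measurable_expabs3.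
  apply: measurable_cos; apply: measurable_funD; last exact: measurable_cst.
  apply: measurable_dot; first exact: measurable_cst.
  by apply: measurable_subR3; [exact: measurable_id|exact: measurable_cst].
by move=> x _; rewrite /= lee_fin normrM ler_piMr// normr_cos_le1.
Qed.

(** The coordinates are integrated out one at a time, the remaining ones acting as a constant phase;
    each integration releases one Poisson factor. *)
Lemma Rintegral_expabs3_cos s a h c : 0 < s ->
  \int[leb3]_x (expabs3 s a x * cos (dot h (x - a) + c)) = cos c * poisson3 s h.
Proof.
move=> s0; have := integrable_expabs3_cos a h c s0.
move=> int3; rewrite -[LHS](@Rintegral_prod12 _ _ _ _ R leb2 leb1 _ int3).
pose e (i t : R) : R := expR (- (s * `|t - i|)).
pose w (t : R) : R := 2 * s / (s ^+ 2 + t ^+ 2).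
transitivity (\int[leb2]_y (e a.1.1 y.1 * e a.1.2 y.2 * cos (h.1.1 * (y.1 -
  a.1.1) + h.1.2 * (y.2 - a.1.2) + c) * w h.2)).
  apply: eq_Rintegral => -[y1 y2] _ /=.
  rewrite -mulrA -(Rintegral_expRabs_cos R s h.2 _ a.2 s0).
  rewrite -(RintegralZl _ measurableT (integrable_expRabs_cos _ _ _ _ _ s0)).
  apply: eq_Rintegral => t _; rewrite dotE /expabs3 /= -mulrA.
  by congr (_ * (_ * cos _)); ring.
have int2 : leb2.-integrable setT (EFin \o (fun y : measurableTypeR R *
  measurableTypeR R => e a.1.1 y.1 * e a.1.2 y.2 * cos (h.1.1 * (y.1 - a.1.1) +
  h.1.2 * (y.2 - a.1.2) + c))).
  have := @integrable_tensor _ _ _ _ _ leb1 leb1 (e a.1.1) (e a.1.2)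
    (integrable_expRabs _ _ _ s0) (integrable_expRabs _ _ _ s0).
  move=> /le_integrable; apply => //.
    apply/measurable_EFinP/measurable_funM.
      apply: measurable_funM.
        exact: (measurableT_comp (measurable_expRabs R s a.1.1) measurable_fst).
      exact: (measurableT_comp (measurable_expRabs R s a.1.2) measurable_snd).
    apply: measurable_cos; apply: measurable_funD => //; apply: measurable_funD;
      apply: measurable_funM => //; apply: measurable_funB => //.
  by move=> x _; rewrite /= lee_fin normrM ler_piMr// normr_cos_le1.
rewrite (RintegralZr _ measurableT int2).
rewrite -[X in X * _](@Rintegral_prod12 _ _ _ _ R leb1 leb1 _ int2) /poisson3
  -/(w _) -/(w _) -/(w _) mulrA; congr (_ * _).
rewrite mulrA -(Rintegral_expRabs_cos R s h.1.1 c a.1.1 s0).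
rewrite -(RintegralZr _ measurableT (integrable_expRabs_cos _ _ _ _ _ s0)).
apply: eq_Rintegral => y1 _ /=.
rewrite -mulrA -(Rintegral_expRabs_cos R s h.1.2 _ a.1.2 s0).
rewrite -(RintegralZl _ measurableT (integrable_expRabs_cos _ _ _ _ _ s0)).
apply: eq_Rintegral => y2 _ /=; rewrite -mulrA.
by congr (_ * (_ * cos _)); ring.
Qed.
End smearing.

(** * Exchange of position and momentum integrals *)

Section smeared_density.
Variable R : realType.
Local Notation leb1 := (leb1 R).
Local Notation leb2 := (leb2 R).
Local Notation leb3 := (leb3 R).
Local Notation leb6 := (leb6 R).
Variables (kr ki : R3 R * R3 R -> R) (q : R3 R -> R) (s : R) (a : R3 R).
Hypotheses (mkr : measurable_fun setT kr) (mki : measurable_fun setT ki).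
Hypotheses (kr1 : forall z, `|kr z| <= 1) (ki1 : forall z, `|ki z| <= 1).
Hypotheses (q0 : forall p, 0 <= q p) (Iq : leb3.-integrable setT (EFin \o q)).
Hypothesis s0 : 0 < s.
Implicit Types p k x : R3 R.

(** Real part of the integrand of [kernel_density] for the packet q(p) e^(-i a.p), with [kr] and
    [ki] in the roles of Re K and Im K. *)
Definition phase_density p k x : R := q p * q k *
  (kr (k, p) * cos (dot (p - k) (x - a)) - ki (k, p) * sin (dot (p - k) (x - a))).

Let mq : measurable_fun setT q.
Proof. by apply/measurable_EFinP; exact: measurable_int Iq. Qed.

Lemma measurable_phase_density d (T : measurableType d) (P K X : T -> R3 R) :
  measurable_fun setT P -> measurable_fun setT K -> measurable_fun setT X ->
  measurable_fun setT (fun z => phase_density (P z) (K z) (X z)).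
Proof.
move=> mP mK mX; have mKP := measurable_fun_pair mK mP.
have md : measurable_fun setT (fun z => dot (P z - K z) (X z - a)).
  apply: measurable_dot; apply: measurable_subR3 => //; exact: measurable_cst.
apply: measurable_funM.
  by apply: measurable_funM; [exact: (measurableT_comp mq mP)|exact:
    (measurableT_comp mq mK)].
apply: measurable_funB; apply: measurable_funM.
- exact: (measurableT_comp mkr mKP).
- exact: measurable_cos.
- exact: (measurableT_comp mki mKP).
- exact: measurable_sin.
Qed.

Lemma phase_density_bound p k x : `|phase_density p k x| <= 2 * q p * q k.
Proof.
rewrite /phase_density normrM ger0_norm ?mulr_ge0// -mulrA mulrC ler_wpM2r
  ?mulr_ge0//.
rewrite (le_trans (ler_normB _ _))// !normrM [X in _ <= X](_ : 2 = 1 * 1 + 1 * 1)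
  ?mulr1//.
rewrite lerD// mulr_ile1// ?kr1 ?ki1 ?normr_cos_le1//.
by rewrite ler_norml sin_geN1 sin_le1.
Qed.

Let Iq2 : leb3.-integrable setT (EFin \o (fun p => 2 * q p)).
Proof. exact: (integrableZl measurableT 2 Iq). Qed.

Lemma integrable_phase_density x :
  leb6.-integrable setT (EFin \o (fun z => phase_density z.1 z.2 x)).
Proof.
apply: (le_integrable _ _ _ (integrable_tensor Iq2 Iq)) => //.
  apply/measurable_EFinP; apply: measurable_phase_density.
  - exact: measurable_fst.
  - exact: measurable_snd.
  - exact: measurable_cst.
move=> [p k] _; rewrite /= lee_fin (le_trans (phase_density_bound _ _ _))//.
by rewrite ler_norm.
Qed.

(** The bound 2 q(p) q(k) on the density is constant in x; integrability in x comes from the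
    weight. *)
Let integrable_smeared : (leb3 \x leb6)%E.-integrable setT
  (EFin \o (fun z => expabs3 s a z.1 * phase_density z.2.1 z.2.2 z.1)).
Proof.
have := @integrable_tensor _ _ _ _ R leb3 leb6 _ _ (integrable_expabs3 a s0)
  (@integrable_tensor _ _ _ _ R leb3 leb3 _ _ Iq2 Iq).
move=> /le_integrable; apply => //.
  apply/measurable_EFinP; apply: measurable_funM.
    exact: (measurableT_comp (measurable_expabs3 s a) measurable_fst).
  apply: measurable_phase_density.
  - exact: (measurableT_comp measurable_fst measurable_snd).
  - exact: (measurableT_comp measurable_snd measurable_snd).
  - exact: measurable_fst.
move=> [x [p k]] _; rewrite /= lee_fin !normrM ler_pM//.
rewrite -!normrM (le_trans (phase_density_bound _ _ _))//.
by rewrite ler_norm.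
Qed.

Let sin_cos (t : R) : sin t = cos (t + - (pi / 2)).
Proof. by rewrite cosD cosN sinN cos_pihalf sin_pihalf; ring. Qed.

(** The weight is even about a, so the sine term integrates to 0. This is why only the real part of
    K has to be controlled. *)
Lemma Rintegral_smeared_phase p k :
  \int[leb3]_x (expabs3 s a x * phase_density p k x) =
  q p * q k * kr (k, p) * poisson3 s (p - k).
Proof.
have I0 := integrable_expabs3_cos a (p - k) 0 s0.
have I1 := integrable_expabs3_cos a (p - k) (- (pi / 2)) s0.
have e0 := Rintegral_expabs3_cos a (p - k) 0 s0.
have e1 := Rintegral_expabs3_cos a (p - k) (- (pi / 2)) s0.
rewrite cos0 mul1r in e0; rewrite cosN cos_pihalf mul0r in e1.
pose u := q p * q k * kr (k, p); pose v := q p * q k * ki (k, p).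
transitivity (\int[leb3]_x (u * (expabs3 s a x * cos (dot (p - k) (x - a) + 0)) -
   v * (expabs3 s a x * cos (dot (p - k) (x - a) + - (pi / 2))))).
  by apply: eq_Rintegral => x _; rewrite -sin_cos addr0 /u /v /phase_density; ring.
rewrite (RintegralB measurableT); [|exact: (integrableZl measurableT u I0)|exact:
  (integrableZl measurableT v I1)].
by rewrite (RintegralZl _ measurableT I0) (RintegralZl _ measurableT I1) e0 e1
  mulr0 subr0.
Qed.

Lemma smeared_densityE :
  \int[leb3]_x (expabs3 s a x * \int[leb3]_p \int[leb3]_k phase_density p k x) =
  \int[leb6]_z (q z.1 * q z.2 * kr (z.2, z.1) * poisson3 s (z.1 - z.2)).
Proof.
transitivity (\int[leb3]_x \int[leb6]_z (expabs3 s a x * phase_density z.1 z.2 x)).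
  apply: eq_Rintegral => x _.
  rewrite (RintegralZl _ measurableT (integrable_phase_density x)); congr (_ * _).
  exact: (@Rintegral_prod12 _ _ _ _ R leb3 leb3 _ (integrable_phase_density x)).
have := @Rintegral_prod12 _ _ _ _ R leb3 leb6 _ integrable_smeared => /= ->.
have := @Rintegral_prod21 _ _ _ _ R leb3 leb6 _ integrable_smeared => /= <-.
by apply: eq_Rintegral => -[p k] _; rewrite Rintegral_smeared_phase.
Qed.

Lemma poisson3_ge0 h : 0 <= poisson3 s h.
Proof.
have w0 t : 0 <= 2 * s / (s ^+ 2 + t ^+ 2).
  by rewrite divr_ge0 ?addr_ge0 ?sqr_ge0// mulr_ge0// ltW.
by apply: mulr_ge0; [apply: mulr_ge0|]; exact: w0.
Qed.

Lemma poisson_le (t : R) : 2 * s / (s ^+ 2 + t ^+ 2) <= 2 / s.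
Proof.
have s20 : 0 < s ^+ 2 by rewrite exprn_gt0.
have st0 : 0 < s ^+ 2 + t ^+ 2 by rewrite ltr_wpDr ?sqr_ge0.
rewrite ler_pdivrMr// mulrAC ler_pdivlMr// -mulrA -expr2 ler_pM2l//.
by rewrite lerDl sqr_ge0.
Qed.

Let measurable_poisson d (T : measurableType d) (f : T -> R) :
  measurable_fun setT f -> measurable_fun setT (fun z => 2 * s / (s ^+ 2 + f z ^+
    2)).
Proof.
move=> mf; apply: (measurableT_comp (f := fun t : R => 2 * s / (s ^+ 2 + t ^+
  2))) => //.
apply: continuous_measurable_fun => t.
have h : s ^+ 2 + t ^+ 2 != 0 by rewrite gt_eqF// ltr_wpDr ?sqr_ge0// exprn_gt0.
apply: cvgM; first exact: cvg_cst.
apply: cvgV => //; apply: cvgD; first exact: cvg_cst.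
exact: exprn_continuous.
Qed.

(** Since q and the Poisson kernel are nonnegative, [kr] may be replaced under the integral by its
    lower bound; the constant C, the maximum of the Poisson kernel, provides the integrable
    majorants. *)
Lemma smeared_density_ge (e : R) : (forall p k, q p != 0 -> q k != 0 -> 1 - e <=
  kr (k, p)) ->
  (1 - e) * \int[leb3]_p (q p * \int[leb3]_k (q k * poisson3 s (p - k))) <=
  \int[leb3]_x (expabs3 s a x * \int[leb3]_p \int[leb3]_k phase_density p k x).
Proof.
move=> he; rewrite smeared_densityE.
pose C := (2 / s) * (2 / s) * (2 / s).
have W h : poisson3 s h <= C.
  have w0 t : 0 <= 2 * s / (s ^+ 2 + t ^+ 2).
    by rewrite divr_ge0 ?addr_ge0 ?sqr_ge0// mulr_ge0// ltW.
  have w2 t u : 0 <= 2 * s / (s ^+ 2 + t ^+ 2) * (2 * s / (s ^+ 2 + u ^+ 2)) by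
    apply: mulr_ge0; exact: w0.
  apply: ler_pM; [exact: w2|exact: w0| |exact: poisson_le].
  by apply: ler_pM; [exact: w0|exact: w0|exact: poisson_le|exact: poisson_le].
have C0 : 0 <= C by rewrite (le_trans (poisson3_ge0 0)).
have pw p k : 0 <= q p * q k * poisson3 s (p - k).
  by apply: mulr_ge0; [exact: mulr_ge0|exact: poisson3_ge0].
have mW d (T : measurableType d) (P K : T -> R3 R) : measurable_fun setT P ->
  measurable_fun setT K ->
    measurable_fun setT (fun z => poisson3 s (P z - K z)).
  move=> mP mK; have [h1 h2 h3] := measurable_coords (measurable_subR3 mP mK).
  by apply: measurable_funM; [apply: measurable_funM|]; apply: measurable_poisson.
have Cq : leb3.-integrable setT (EFin \o (fun p => C * q p)) by exact:
  (integrableZl measurableT C Iq).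
have mqq : measurable_fun setT (fun z : R3 R * R3 R => q z.1 * q z.2).
  by apply: measurable_funM; [exact: (measurableT_comp mq measurable_fst)|exact:
    (measurableT_comp mq measurable_snd)].
have mWz : measurable_fun setT (fun z : R3 R * R3 R => poisson3 s (z.1 - z.2)).
  by apply: mW; [exact: measurable_fst|exact: measurable_snd].
have I1 : leb6.-integrable setT (EFin \o (fun z => q z.1 * q z.2 * poisson3 s
  (z.1 - z.2))).
  apply: (le_integrable _ _ _ (integrable_tensor Cq Iq)) => //.
    by apply/measurable_EFinP; apply: measurable_funM.
  move=> [p k] _; rewrite /= lee_fin (ger0_norm (pw _ _)) ger0_norm.
    by rewrite mulrC mulrA ler_wpM2r// ler_wpM2r.
  by apply: mulr_ge0 => //; apply: mulr_ge0.
have I2 : leb6.-integrable setT (EFin \o (fun z => q z.1 * q z.2 * kr (z.2, z.1)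
  * poisson3 s (z.1 - z.2))).
  apply: (le_integrable _ _ _ I1) => //.
    apply/measurable_EFinP; apply: measurable_funM => //;
      apply: measurable_funM => //.
    exact: (measurableT_comp mkr (measurable_fun_pair measurable_snd
      measurable_fst)).
  move=> [p k] _; rewrite /= lee_fin mulrAC normrM ler_piMr//.
have -> : \int[leb3]_p (q p * \int[leb3]_k (q k * poisson3 s (p - k))) =
    \int[leb6]_z (q z.1 * q z.2 * poisson3 s (z.1 - z.2)).
  rewrite -(@Rintegral_prod12 _ _ _ _ R leb3 leb3 _ I1)/=.
  apply: eq_Rintegral => p _; rewrite -RintegralZl//;
    first by apply: eq_Rintegral => k _; rewrite mulrA.
  apply: (le_integrable _ _ _ Cq) => //.
    apply/measurable_EFinP; apply: measurable_funM => //.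
    by apply: mW; [exact: measurable_cst|exact: measurable_id].
  move=> k _; rewrite /= lee_fin ger0_norm; last by apply: mulr_ge0 => //;
    exact: poisson3_ge0.
  rewrite ger0_norm; last exact: mulr_ge0.
  by rewrite mulrC ler_wpM2r.
rewrite -(RintegralZl _ measurableT I1).
apply: le_Rintegral => //; first exact: (integrableZl measurableT (1 - e) I1).
move=> [p k] _ /=.
(* Off the support of q both sides vanish, so the bound on [kr] is used only where it is assumed. *)
have [p0|p0] := eqVneq (q p) 0; first by rewrite p0 !mul0r mulr0.
have [k0|k0] := eqVneq (q k) 0; first by rewrite k0 !(mul0r, mulr0).
rewrite mulrA ler_wpM2r ?poisson3_ge0// mulrC ler_wpM2l ?mulr_ge0//.
exact: he.
Qed.
End smeared_density.

(** * Mass of the Poisson kernel on cubes *)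

Section box_integrals.
Variable R : realType.
Local Notation leb1 := (leb1 R).
Local Notation leb3 := (leb3 R).
Implicit Types (u L s t e : R) (v p k : R3 R).

Definition box u L : R -> R := \1_(`[u - L, u + L]%classic : set R).

Lemma box_ge0 u L t : 0 <= box u L t.
Proof. by rewrite /box indicE. Qed.

Lemma box_le1 u L t : box u L t <= 1.
Proof. by rewrite /box indicE; case: (_ \in _). Qed.

Lemma box_neq0 u L t : box u L t != 0 -> `|t - u| <= L.
Proof.
rewrite /box indicE; case: (boolP (_ \in _)); last by rewrite eqxx.
by rewrite inE/= in_itv/= => /andP[h1 h2] _; rewrite ler_norml; apply/andP;
  split; lra.
Qed.

Lemma integrable_box u L : leb1.-integrable setT (EFin \o box u L).
Proof.
apply/integrableP; split; first by apply/measurable_EFinP; exact: measurable_indic.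
under eq_integral do rewrite gee0_abs ?lee_fin ?box_ge0//.
rewrite integral_indic//= setIT lebesgue_measure_itv/=.
by case: ifP => // _; rewrite ltry.
Qed.

Lemma measurable_box u L : measurable_fun setT (box u L).
Proof. exact: measurable_indic. Qed.

Lemma Rintegral_box u L : 0 <= L -> \int[leb1]_t box u L t = 2 * L.
Proof.
move=> L0; rewrite /Rintegral integral_indic//= setIT lebesgue_measure_itv/=
  lte_fin.
case: ifPn => h /=; first by ring.
have : L = 0 by move: h; rewrite -leNgt; lra.
by move=> ->; rewrite mulr0.
Qed.

Definition poisson_box u L s t : R :=
  2 * (atan ((u + L - t) / s) - atan ((u - L - t) / s)).

Let continuous_poisson s t : 0 < s -> continuous (fun r => 2 * s / (s ^+ 2 + (t -
  r) ^+ 2)).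
Proof.
move=> s0 r; have h : s ^+ 2 + (t - r) ^+ 2 != 0.
  by rewrite gt_eqF// ltr_wpDr ?sqr_ge0// exprn_gt0.
apply: cvgM; first exact: cvg_cst.
apply: cvgV => //; apply: cvgD; first exact: cvg_cst.
apply: (@cvg_comp _ _ _ (fun r => t - r) (fun x => x ^+ 2));
  last exact: exprn_continuous.
by apply: cvgB; [exact: cvg_cst|exact: cvg_id].
Qed.

Lemma integrable_box_poisson u L s t : 0 < s ->
  leb1.-integrable setT (EFin \o (fun r => box u L r * (2 * s / (s ^+ 2 + (t - r)
    ^+ 2)))).
Proof.
move=> s0.
apply: (le_integrable _ _ _ (integrableZl measurableT (2 / s) (integrable_box u
  L))) => //.
  apply/measurable_EFinP; apply: measurable_funM; first exact: measurable_box.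
  by apply: continuous_measurable_fun; exact: continuous_poisson.
move=> r _; rewrite /= lee_fin ger0_norm; last first.
  by rewrite mulr_ge0 ?box_ge0// divr_ge0 ?addr_ge0 ?sqr_ge0// mulr_ge0// ltW.
rewrite (le_trans _ (ler_norm _))// mulrC ler_wpM2r ?box_ge0//.
have s20 : 0 < s ^+ 2 by rewrite exprn_gt0.
have st0 : 0 < s ^+ 2 + (t - r) ^+ 2 by rewrite ltr_wpDr ?sqr_ge0.
rewrite ler_pdivrMr// mulrAC ler_pdivlMr// -mulrA -expr2 ler_pM2l//.
by rewrite lerDl sqr_ge0.
Qed.

Lemma Rintegral_box_poisson u L s t : 0 < s -> 0 < L ->
  \int[leb1]_r (box u L r * (2 * s / (s ^+ 2 + (t - r) ^+ 2))) = poisson_box u L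
    s t.
Proof.
move=> s0 L0; rewrite /poisson_box -(Rintegral_poisson R s t (u - L) (u + L))//;
  last by lra.
rewrite [RHS]Rintegral_mkcond; apply: eq_Rintegral => r _.
by rewrite /box indicE patchE; case: ifP => h; rewrite ?h ?mul1r ?mul0r.
Qed.

Lemma poisson_box_bound u L s t : 0 < s -> 0 < L -> 0 <= poisson_box u L s t <= 2
  * pi.
Proof.
move=> s0 L0; rewrite /poisson_box.
have : atan ((u - L - t) / s) <= atan ((u + L - t) / s).
  by apply: le_atan; rewrite ler_pM2r ?invr_gt0//; lra.
have := @atan_ltpi2 R ((u + L - t) / s); have := @atan_gtNpi2 R ((u - L - t) / s).
by move=> h1 h2 h3; apply/andP; split; lra.
Qed.

Lemma integrable_box_poisson_box u L s : 0 < s -> 0 < L ->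
  leb1.-integrable setT (EFin \o (fun t => box u L t * poisson_box u L s t)).
Proof.
move=> s0 L0.
apply: (le_integrable _ _ _ (integrableZl measurableT (2 * pi) (integrable_box u
  L))) => //.
  apply/measurable_EFinP; apply: measurable_funM; first exact: measurable_box.
  apply: continuous_measurable_fun => t; apply: cvgM; first exact: cvg_cst.
  have ca c : {for t, continuous (fun t => atan ((c - t) / s))}.
    apply: (@cvg_comp _ _ _ (fun t => (c - t) / s) (@atan R));
      last exact: continuous_atan.
    apply: cvgM; last exact: cvg_cst.
    by apply: cvgB; [exact: cvg_cst|exact: cvg_id].
  by apply: cvgB; exact: ca.
move=> t _; have /andP[h1 h2] := poisson_box_bound u t s0 L0.
rewrite /= lee_fin [X in X <= _]ger0_norm; last by apply: mulr_ge0 => //;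
  exact: box_ge0.
by rewrite (le_trans _ (ler_norm _))// mulrC ler_wpM2r ?box_ge0.
Qed.

(** A point t with |t - u| <= (1 - e) L is at distance at least e L from both ends of the interval,
    so [poisson_box] is at least 4 atan (e L / s) there; this smaller interval has length 2 (1 - e)
    L. *)
Lemma Rintegral_box_poisson_box_ge u L s e : 0 < s -> 0 < L -> 0 < e < 1 ->
  8 * (1 - e) * L * atan (e * L / s) <= \int[leb1]_t (box u L t * poisson_box u L
    s t).
Proof.
move=> s0 L0 /andP[e0 e1].
have eL : 0 <= (1 - e) * L by apply: mulr_ge0; lra.
apply: (@le_trans _ _ (\int[leb1]_t (4 * atan (e * L / s) * box u ((1 - e) * L)
  t))).
  rewrite (RintegralZl _ measurableT (integrable_box _ _)) Rintegral_box//.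
  by rewrite le_eqVlt; apply/orP; left; apply/eqP; ring.
apply: le_Rintegral => //.
- exact: (integrableZl measurableT (4 * atan (e * L / s)) (integrable_box u ((1 -
  e) * L))).
- exact: integrable_box_poisson_box.
move=> t _; have /andP[h1 h2] := poisson_box_bound u t s0 L0.
have [->|/box_neq0 ht] := eqVneq (box u ((1 - e) * L) t) 0.
  by rewrite mulr0 mulr_ge0 ?box_ge0.
have L' : (1 - e) * L <= L by nra.
have eLs : 0 <= e * L / s by rewrite divr_ge0 ?ltW// mulr_gt0.
have -> : box u L t = 1.
  rewrite /box indicE mem_set//= in_itv/=; move: ht;
    rewrite ler_norml => /andP[? ?].
  by apply/andP; split; lra.
have a0 : 0 <= atan (e * L / s) by rewrite -(@atan0 R); exact: le_atan.
rewrite mul1r; apply: (@le_trans _ _ (4 * atan (e * L / s))).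
  by rewrite ler_piMr ?box_le1// mulr_ge0.
move: ht; rewrite ler_norml => /andP[ht1 ht2]; rewrite /poisson_box.
have : atan (e * L / s) <= atan ((u + L - t) / s).
  by apply: le_atan; rewrite ler_pM2r ?invr_gt0//; lra.
have : atan ((u - L - t) / s) <= - atan (e * L / s).
  by rewrite -atanN; apply: le_atan; rewrite -mulNr ler_pM2r ?invr_gt0//; lra.
lra.
Qed.

Definition box3 (c : R) v L p : R := c * box v.1.1 L p.1.1 * box v.1.2 L p.1.2 *
  box v.2 L p.2.

Lemma integrable_box3 c v L : leb3.-integrable setT (EFin \o box3 c v L).
Proof.
exact: (integrable_tensor3 (integrableZl measurableT c (integrable_box v.1.1 L))
  (integrable_box v.1.2 L) (integrable_box v.2 L)).
Qed.

Lemma Rintegral_box3_poisson c v L s e : 0 < s -> 0 < L -> 0 < e < 1 ->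
  c ^+ 2 * (8 * (1 - e) * L * atan (e * L / s)) ^+ 3 <=
  \int[leb3]_p (box3 c v L p * \int[leb3]_k (box3 c v L k * poisson3 s (p - k))).
Proof.
move=> s0 L0 e01; have /andP[e0 e1] := e01.
pose G p : R := c ^+ 2 * (box v.1.1 L p.1.1 * poisson_box v.1.1 L s p.1.1) *
  (box v.1.2 L p.1.2 * poisson_box v.1.2 L s p.1.2) * (box v.2 L p.2 *
    poisson_box v.2 L s p.2).
have -> : \int[leb3]_p (box3 c v L p * \int[leb3]_k (box3 c v L k * poisson3 s (p
  - k))) = \int[leb3]_p G p.
  apply: eq_Rintegral => p _.
  have -> : \int[leb3]_k (box3 c v L k * poisson3 s (p - k)) =
    c * poisson_box v.1.1 L s p.1.1 * poisson_box v.1.2 L s p.1.2 * poisson_box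
      v.2 L s p.2.
    rewrite -!(Rintegral_box_poisson _ _ s0 L0).
    have I := fun u t => integrable_box_poisson u L t s0.
    have E := Rintegral_tensor3 (integrableZl measurableT c (I v.1.1 p.1.1)) (I
      v.1.2 p.1.2) (I v.2 p.2).
    rewrite (RintegralZl _ measurableT (I _ _)) in E; rewrite -E.
    by apply: eq_Rintegral => k _; rewrite /box3 /poisson3; ring.
  by rewrite /box3 /G; ring.
have I u := integrable_box_poisson_box u s0 L0.
have -> : \int[leb3]_p G p = c ^+ 2 * \int[leb1]_t (box v.1.1 L t * poisson_box
  v.1.1 L s t) *
    \int[leb1]_t (box v.1.2 L t * poisson_box v.1.2 L s t) *
    \int[leb1]_t (box v.2 L t * poisson_box v.2 L s t).
  have E := Rintegral_tensor3 (integrableZl measurableT (c ^+ 2) (I v.1.1)) (I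
    v.1.2) (I v.2).
  by rewrite (RintegralZl _ measurableT (I _)) in E; rewrite -E.
have a0 : 0 <= 8 * (1 - e) * L * atan (e * L / s).
  apply: mulr_ge0; first by apply: mulr_ge0; [apply: mulr_ge0|]; lra.
  by rewrite -(@atan0 R); apply: le_atan; rewrite divr_ge0 ?ltW// mulr_gt0.
have b u := Rintegral_box_poisson_box_ge u s0 L0 e01.
move: a0; set A := 8 * (1 - e) * L * atan _ => a0.
have -> : A ^+ 3 = A * A * A by ring.
rewrite -(mulrA (c ^+ 2)) -(mulrA (c ^+ 2)) ler_wpM2l ?sqr_ge0//.
by apply: ler_pM => //; [exact: mulr_ge0|apply: ler_pM].
Qed.
End box_integrals.

(** * Effects on the space of square integrable functions *)

Section complex_L2.
Local Open Scope complex_scope.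
Variable R : realType.
Local Notation mu := (@mu3 R).
Local Notation Re := (@complex.Re R).
Local Notation Im := (@complex.Im R).
Implicit Types (u v f g w : R3 R -> R[i]) (c : R[i]).

Definition sqmod u (p : R3 R) : R := Re (u p) ^+ 2 + Im (u p) ^+ 2.

Lemma sqmod_ge0 u p : 0 <= sqmod u p.
Proof. by rewrite addr_ge0 ?sqr_ge0. Qed.

Lemma normc_sqmod u p : Normc.normc (u p) = Num.sqrt (sqmod u p).
Proof. by rewrite /sqmod; case: (u p). Qed.

Let pow2 u p : (`|(Normc.normc (u p))%:E| `^ 2 = (sqmod u p)%:E)%E.
Proof.
rewrite normc_sqmod abse_EFin ger0_norm ?sqrtr_ge0// poweR_EFin.
by rewrite -[2]/(2%:R) powR_mulrn ?sqrtr_ge0// sqr_sqrtr// sqmod_ge0.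
Qed.

Lemma L2norm_int u : (L2norm u = (\int[mu]_p (sqmod u p)%:E) `^ (2^-1))%E.
Proof. by rewrite /L2norm unlock; under eq_integral do rewrite pow2. Qed.

Lemma measurable_sqmod u : Cmeasurable_fun setT u -> measurable_fun setT (sqmod u).
Proof. by move=> [m1 m2]; apply: measurable_funD; apply: measurable_funX. Qed.

Lemma L2P u : L2 u <-> Cmeasurable_fun setT u /\ mu.-integrable setT (EFin \o
  sqmod u).
Proof.
have N p : `|(EFin \o sqmod u) p|%E = (sqmod u p)%:E by rewrite /= ger0_norm
  ?sqmod_ge0.
have E : (L2norm u < +oo)%E <-> (\int[mu]_p (sqmod u p)%:E < +oo)%E.
  rewrite L2norm_int; split => [h|]; last exact: poweR_lty.
  have := poweR_lty 2 h; rewrite -poweRrM mulVf// poweRe1//.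
  by apply: integral_ge0 => p _; rewrite lee_fin sqmod_ge0.
split=> [[mu_ n]|[mu_ /integrableP[_ i]]]; split => //.
  apply/integrableP; split; first by apply/measurable_EFinP;
    exact: measurable_sqmod.
  under eq_integral do rewrite N.
  exact/E.
apply/E; move: i.
by under eq_integral do rewrite N.
Qed.

Definition nsq u : R := \int[mu]_p sqmod u p.

Lemma nsq_ge0 u : 0 <= nsq u.
Proof. by apply: Rintegral_ge0 => p _; exact: sqmod_ge0. Qed.

Lemma L2norm_nsq u : L2 u -> L2norm u = (Num.sqrt (nsq u))%:E.
Proof.
move=> /L2P[_ iu]; rewrite L2norm_int -[X in (X `^ _)%E]fineK;
  last exact: integrable_fin_num.
by rewrite poweR_EFin powR12_sqrt// nsq_ge0.
Qed.

Lemma Cmeasurable_lin c f g : Cmeasurable_fun setT f -> Cmeasurable_fun setT g ->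
  Cmeasurable_fun setT (fun p => c * f p + g p).
Proof.
move=> [f1 f2] [g1 g2]; split.
  rewrite (_ : (fun _ => _) = (fun p => Re c * Re (f p) - Im c * Im (f p) + Re (g
    p))).
    apply: measurable_funD => //; apply: measurable_funB;
      apply: measurable_funM => //.
  by apply/funext => p; case: c (f p) (g p) => [a b] [a1 b1] [a2 b2].
rewrite (_ : (fun _ => _) = (fun p => Re c * Im (f p) + Im c * Re (f p) + Im (g
  p))).
  by apply: measurable_funD => //; apply: measurable_funD; apply: measurable_funM.
by apply/funext => p; case: c (f p) (g p) => [a b] [a1 b1] [a2 b2].
Qed.

Lemma L2_lin c f g : L2 f -> L2 g -> L2 (fun p => c * f p + g p).
Proof.
move=> /L2P[mf If] /L2P[mg Ig]; apply/L2P; split; first exact: Cmeasurable_lin.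
(* The majorant comes from |c f + g|^2 <= 2 |c|^2 |f|^2 + 2 |g|^2. *)
pose C := 2 * (Re c ^+ 2 + Im c ^+ 2).
have := integrableD measurableT (integrableZl measurableT C If) (integrableZl
  measurableT 2 Ig).
move=> /le_integrable; apply => //.
  by apply/measurable_EFinP; apply: measurable_sqmod; exact: Cmeasurable_lin.
move=> p _; rewrite /= lee_fin ger0_norm ?sqmod_ge0// (le_trans _ (ler_norm _))//.
rewrite /C /sqmod {C}; case: c (f p) (g p) => [a b] [a1 b1] [a2 b2] /=.
have := sqr_ge0 (a * a1 - b * b1 - a2); have := sqr_ge0 (a * b1 + b * a1 - b2); nra.
Qed.

(** Both the real and the imaginary part of conj(u) v have the form a a' + b b', and |x y| <= x^2 +
    y^2. *)
Let cross_integrable (a b a' b' : R3 R -> R) :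
  measurable_fun setT a -> measurable_fun setT b ->
  measurable_fun setT a' -> measurable_fun setT b' ->
  mu.-integrable setT (EFin \o (fun p => a p ^+ 2 + b p ^+ 2)) ->
  mu.-integrable setT (EFin \o (fun p => a' p ^+ 2 + b' p ^+ 2)) ->
  mu.-integrable setT (EFin \o (fun p => a p * a' p + b p * b' p)).
Proof.
move=> ma mb ma' mb' I I'; have := integrableD measurableT I I'.
move=> /le_integrable; apply => //.
  by apply/measurable_EFinP; apply: measurable_funD; apply: measurable_funM.
move=> p _; rewrite /= lee_fin [X in _ <= X]ger0_norm;
  last by rewrite !addr_ge0 ?sqr_ge0.
have sq (x y : R) : `|x * y| <= x ^+ 2 + y ^+ 2.
  by rewrite ler_norml; apply/andP; split; have := sqr_ge0 (x + y);
    have := sqr_ge0 (x - y); nra.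
by rewrite (le_trans (ler_normD _ _))// addrACA lerD.
Qed.

Let Re_conjM (x y : R[i]) : Re (conjc x * y) = Re x * Re y + Im x * Im y.
Proof. by case: x y => [a b] [a' b'] /=; ring. Qed.

Let Im_conjM (x y : R[i]) : Im (conjc x * y) = Re x * Im y + - Im x * Re y.
Proof. by case: x y => [a b] [a' b'] /=; ring. Qed.

Lemma Cintegrable_inner u v : L2 u -> L2 v -> Cintegrable setT (fun p => conjc (u
  p) * v p).
Proof.
move=> /L2P[[mu1 mu2] Iu] /L2P[[mv1 mv2] Iv]; split.
  by under eq_fun do rewrite Re_conjM; exact: cross_integrable.
under eq_fun do rewrite Im_conjM; apply: cross_integrable => //;
  first exact: measurable_funN.
  move: Iu; congr (mu.-integrable _ _); apply/funext => p /=.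
  by rewrite /sqmod sqrrN.
by move: Iv; congr (mu.-integrable _ _); apply/funext => p /=; rewrite /sqmod addrC.
Qed.

Lemma inner_linr c u f g : L2 u -> L2 f -> L2 g ->
  inner u (fun p => c * f p + g p) = c * inner u f + inner u g.
Proof.
move=> Lu Lf Lg; have [If If'] := Cintegrable_inner Lu Lf;
  have [Ig Ig'] := Cintegrable_inner Lu Lg.
have lin (a b : R) (f1 f2 f3 : R3 R -> R) : mu.-integrable setT (EFin \o f1) ->
    mu.-integrable setT (EFin \o f2) -> mu.-integrable setT (EFin \o f3) ->
    \int[mu]_p (a * f1 p + b * f2 p + f3 p) = a * \int[mu]_p f1 p + b *
      \int[mu]_p f2 p + \int[mu]_p f3 p.
  move=> I1 I2 I3.
  have I1' := integrableZl measurableT a I1;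
    have I2' := integrableZl measurableT b I2.
  rewrite (RintegralD measurableT (integrableD measurableT I1' I2') I3).
  by rewrite (RintegralD measurableT I1' I2') !(RintegralZl _ measurableT).
rewrite /inner /Cint.
have -> : \int[mu]_p Re (conjc (u p) * (c * f p + g p)) =
    Re c * \int[mu]_p Re (conjc (u p) * f p) + - Im c * \int[mu]_p Im (conjc (u
      p) * f p) +
    \int[mu]_p Re (conjc (u p) * g p).
  rewrite -lin//; apply: eq_Rintegral => p _.
  by case: c (u p) (f p) (g p) => [a b] [a1 b1] [a2 b2] [a3 b3] /=; ring.
have -> : \int[mu]_p Im (conjc (u p) * (c * f p + g p)) =
    Re c * \int[mu]_p Im (conjc (u p) * f p) + Im c * \int[mu]_p Re (conjc (u p)
      * f p) +
    \int[mu]_p Im (conjc (u p) * g p).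
  rewrite -lin//; apply: eq_Rintegral => p _.
  by case: c (u p) (f p) (g p) => [a b] [a1 b1] [a2 b2] [a3 b3] /=; ring.
by case: c => a b /=; congr (_ +i* _); ring.
Qed.

Lemma inner_conj u v : L2 u -> L2 v -> inner v u = conjc (inner u v).
Proof.
move=> Lu Lv; rewrite /inner /Cint /=; congr (_ +i* _).
  by apply: eq_Rintegral => p _; rewrite !Re_conjM; ring.
rewrite -mulN1r -RintegralZl//; last exact: (Cintegrable_inner Lu Lv).2.
by apply: eq_Rintegral => p _; rewrite !Im_conjM; ring.
Qed.

Lemma inner_linl c u f g : L2 u -> L2 f -> L2 g ->
  inner (fun p => c * f p + g p) u = conjc c * inner f u + inner g u.
Proof.
move=> Lu Lf Lg; rewrite inner_conj//; last exact: L2_lin.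
rewrite inner_linr// (inner_conj Lu Lf) (inner_conj Lu Lg).
by case: c (inner u f) (inner u g) => [a b] [a1 b1] [a2 b2];
  congr (_ +i* _) => /=; ring.
Qed.

Lemma inner_aeeq u f g : L2 u -> L2 f -> L2 g -> aeeq f g -> inner u f = inner u g.
Proof.
move=> Lu Lf Lg [N [mN N0 sN]]; have [If If'] := Cintegrable_inner Lu Lf;
  have [Ig Ig'] := Cintegrable_inner Lu Lg.
have E (h : R[i] -> R) : measurable_fun setT (fun p => (h (conjc (u p) * f
  p))%:E) ->
   measurable_fun setT (fun p => (h (conjc (u p) * g p))%:E) ->
   \int[mu]_p h (conjc (u p) * f p) = \int[mu]_p h (conjc (u p) * g p).
  move=> m1 m2; congr fine; apply: ae_eq_integral => //.
  by exists N; split => // p np; apply: sN => fg; apply: np => _; rewrite fg.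
rewrite /inner /Cint; congr (_ +i* _); apply: E.
- exact: measurable_int If.
- exact: measurable_int Ig.
- exact: measurable_int If'.
- exact: measurable_int Ig'.
Qed.

Lemma inner_self u : L2 u -> inner u u = (nsq u)%:C.
Proof.
move=> Lu; rewrite /inner /Cint /nsq; congr (_ +i* _).
  by apply: eq_Rintegral => p _; rewrite Re_conjM /sqmod !expr2.
rewrite (_ : (fun _ => _) = cst 0); first by rewrite Rintegral_cst// mul0r.
by apply/funext => p; rewrite Im_conjM mulNr mulrC subrr.
Qed.

(** * Norm of an operator between 0 and the identity *)

Section effect.
Variables A A' : (R3 R -> R[i]) -> (R3 R -> R[i]).
Hypotheses (bA : bounded_operator A) (bA' : bounded_operator A').
Hypotheses (pA : positive_operator A) (pA' : positive_operator A').
Hypothesis AA' : forall f, L2 f -> inner f (A f) + inner f (A' f) = inner f f.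

Let form_quadratic c f g : L2 f -> L2 g ->
  inner (fun p => c * g p + f p) (A (fun p => c * g p + f p)) =
  conjc c * c * inner g (A g) + conjc c * inner g (A f) + c * inner f (A g) +
    inner f (A f).
Proof.
move=> Lf Lg; have Lh := L2_lin c Lg Lf.
have LA w : L2 w -> L2 (A w) by exact: op_L2.
have LAl := L2_lin c (LA _ Lg) (LA _ Lf).
rewrite (inner_aeeq Lh (LA _ Lh) LAl (op_linear bA c Lg Lf)).
rewrite inner_linr ?inner_linl//; try exact: LA.
ring.
Qed.

(* With n = |A f|^2, positivity of A on f - A f and A <= I give
   2 n <= <f, A f> + <A f, A (A f)> <= 1 + n; positivity on i A f + f provides
   the symmetry Re <f, A (A f)> = n. *)
Lemma effect_contraction f : L2 f -> nsq f <= 1 -> nsq (A f) <= 1.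
Proof.
move=> Lf f1; have LAf : L2 (A f) by exact: op_L2.
have LAAf : L2 (A (A f)) by exact: op_L2.
have := pA (L2_lin 'i LAf Lf); have := pA (L2_lin (-1) LAf Lf).
rewrite !form_quadratic// inner_self//.
have : Re (inner (A f) (A (A f))) <= nsq (A f).
  have := pA' LAf; have := AA' LAf; rewrite inner_self//.
  case: (inner _ (A (A f))) (inner _ (A' (A f))) => [a b] [a' b'] [<- _].
  by rewrite lecE /= => /andP[_ ?]; lra.
have : Re (inner f (A f)) <= nsq f.
  have := pA' Lf; have := AA' Lf; rewrite inner_self//.
  case: (inner f (A f)) (inner f (A' f)) => [a b] [a' b'] [<- _].
  by rewrite lecE /= => /andP[_ ?]; lra.
have := pA Lf; have := pA LAf; rewrite !lecE.
case: (inner f (A f)) (inner (A f) (A (A f))) (inner f (A (A f))) => [a b] [a'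
  b'] [a2 b2] /=.
move=> /andP[/eqP-> _] /andP[/eqP-> _] h1 h2 /andP[_ h3] /andP[/eqP h4 _].
nra.
Qed.

(** Expand |A f - f|^2 >= 0. *)
Lemma effect_lower f (e : R) : L2 f -> nsq f = 1 -> 1 - e <= Re (inner f (A f)) ->
  1 - 2 * e <= nsq (A f).
Proof.
move=> Lf f1 he; have LAf : L2 (A f) by exact: op_L2.
have := nsq_ge0 (fun p => (-1) * f p + A f p).
have := inner_self (L2_lin (-1) Lf LAf).
rewrite inner_linr// ?inner_linl//; try exact: L2_lin.
rewrite !inner_self// (inner_conj Lf LAf) f1.
case: (inner f (A f)) he => a b /= he [<- _]; nra.
Qed.

(** Expectations close to 1 suffice because |A f|^2 is then close to 1 as well. In the application A
    and A' are the values of T on a ball and on its complement. *)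
Lemma opnorm_effect_eq1 : (forall e : R, 0 < e -> exists f, [/\ L2 f, nsq f = 1 &
  1 - e <= Re (inner f (A f))]) -> opnorm A = 1%:E.
Proof.
move=> H; apply/eqP; rewrite eq_le; apply/andP; split.
  apply: ub_ereal_sup => _ [f [Lf f1] <-].
  have LAf : L2 (A f) by exact: op_L2.
  move: f1; rewrite !L2norm_nsq// !lee_fin => f1.
  rewrite -[X in _ <= X]sqrtr1; apply: ler_wsqrtr; apply: effect_contraction => //.
  by rewrite -(sqr_sqrtr (nsq_ge0 f)) -[X in _ <= X](expr1n _ 2) lerXn2r ?nnegrE
    ?sqrtr_ge0.
apply/lee_addgt0Pr => e e0.
(* [effect_lower] doubles the error. *)
have e20 : 0 < e / 2 by rewrite divr_gt0.
have [f [Lf f1 hf]] := H (e / 2) e20.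
have LAf : L2 (A f) by exact: op_L2.
have h := effect_lower Lf f1 hf.
apply: (@le_trans _ _ (L2norm (A f) + e%:E)%E).
  rewrite L2norm_nsq// -EFinD lee_fin.
  have := sqr_sqrtr (nsq_ge0 (A f)); have := sqrtr_ge0 (nsq (A f)).
  nra.
rewrite leeD2r//; apply: ereal_sup_ubound; exists f => //; split => //.
by rewrite L2norm_nsq// f1 sqrtr1.
Qed.
End effect.
End complex_L2.

(** * Localization of wave packets *)

Section localization.
Variable R : realType.
Local Notation mu := (@mu3 R).
Local Notation Re := (@complex.Re R).
Local Notation Im := (@complex.Im R).

Section pol.
Variable T : set (R3 R) -> (R3 R -> R[i]) -> (R3 R -> R[i]).
Hypothesis hT : POL T.

(* n <f, T(set0) f> converges as n grows, so it vanishes. *)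
Lemma POL_set0 f : L2 f -> inner f (T set0 f) = 0.
Proof.
move=> Lf; set z := inner f _.
have := pol_sigma_additive hT (fun=> measurable0) (@trivIset_set0 _ _ setT) Lf Lf.
rewrite bigcup0// -/z => h.
have {}h : (fun n : nat => (n%:R * z : R[i]^o)) @ \oo --> (z : R[i]^o).
  by move: h; under eq_fun do rewrite sumr_const card_ord -mulr_natl.
have h1 : (fun n : nat => ((n + 1)%:R * z : R[i]^o)) @ \oo --> (z : R[i]^o).
  exact: (cvg_comp _ _ (cvg_addnr 1) h).
have h0 : (fun _ : nat => z : R[i]^o) @ \oo --> (0 : R[i]^o).
  rewrite -(subrr (z : R[i]^o)).
  rewrite (_ : (fun _ : nat => z : R[i]^o) = (fun n : nat => (n + 1)%:R * z -
    n%:R * z : R[i]^o)); last first.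
    by apply/funext => n /=; rewrite natrD mulrDl mul1r addrAC subrr add0r.
  exact: cvgB h1 h.
exact: (cvg_unique (@norm_hausdorff _ R[i]^o) (cvg_cst (z : R[i]^o)) h0).
Qed.

(** Sigma-additivity for the sequence B, ~B, set0, set0, ...; by [POL_set0] the partial sums are
    constant from two terms on, whence the shift of the index by 2. *)
Lemma POL_setC B f : measurable B -> L2 f ->
  inner f (T B f) + inner f (T (~` B) f) = inner f f.
Proof.
move=> mB Lf; pose D n : set (R3 R) := if n is 0%N then B else if n is 1%N then
  ~` B else set0.
have mD n : measurable (D n) by case: n => [|[|n]] //=; exact: measurableC.
have tD : trivIset setT D.
  apply/trivIsetP => -[|[|i]] [|[|j]] //= _ _ _; rewrite ?(setI0, set0I)//.
    exact: setICr.
  exact: setICl.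
have := pol_sigma_additive hT mD tD Lf Lf.
have -> : \bigcup_n D n = setT.
  by apply/seteqP; split => // x _; have [Bx|Bx] := pselect (B x);
    [exists 0%N|exists 1%N].
have LT : L2 (T setT f) by exact: (op_L2 (pol_bounded hT measurableT)).
rewrite (inner_aeeq Lf LT Lf (pol_normalized hT Lf)) => h.
have {h} := cvg_comp _ _ (cvg_addnr 2) h; rewrite /comp.
rewrite (_ : (fun _ => _) = cst (inner f (T B f) + inner f (T (~` B) f) :
  R[i]^o)); last first.
  apply/funext => n; rewrite addn2 !big_ord_recl big1 ?addr0//.
  by move=> i _; exact: POL_set0.
by move=> /(cvg_unique (@norm_hausdorff _ R[i]^o) (cvg_cst _)).
Qed.
End pol.

(** * Densities with nonnegative integrals *)

Section weighted_integrals.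
Variable f : R3 R -> R.
Hypotheses (If : mu.-integrable setT (EFin \o f))
  (f_ge0 : forall D, measurable D -> 0 <= \int[mu]_(x in D) f x).

Let integrableM (g : R3 R -> R) (D : set (R3 R)) : measurable D -> measurable_fun
  setT g ->
  (forall x, D x -> 0 <= g x <= 1) -> mu.-integrable D (EFin \o (fun x => g x * f
    x)).
Proof.
move=> mD mg g01.
apply: (le_integrable _ _ _ (integrableS measurableT mD (@subsetT _ D) If)) => //.
  apply: measurable_funTS; apply/measurable_EFinP; apply: measurable_funM => //.
  by apply/measurable_EFinP; exact: measurable_int If.
move=> x Dx; have /andP[g0 g1] := g01 x Dx.
by rewrite /= lee_fin normrM ger0_norm// ler_piMl.
Qed.

(** Test the hypothesis on D meet N with N = {f < 0}: since 0 <= g <= 1, g f is at least f on N and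
    at least 0 elsewhere. No pointwise sign of f is required. *)
Lemma weighted_Rintegral_ge0 (g : R3 R -> R) (D : set (R3 R)) :
  measurable D -> measurable_fun setT g -> (forall x, D x -> 0 <= g x <= 1) ->
  0 <= \int[mu]_(x in D) (g x * f x).
Proof.
move=> mD mg g01.
have mf : measurable_fun setT f by apply/measurable_EFinP; exact: measurable_int If.
pose N := [set x | f x < 0].
have mN : measurable N.
  rewrite (_ : N = setT `&` f @^-1` `]-oo, 0[%classic); first exact: mf.
  by rewrite setTI; apply/seteqP; split => x; rewrite /N /= in_itv.
have mDN : measurable (D `&` N) by exact: measurableI.
apply: (le_trans (f_ge0 mDN)).
rewrite Rintegral_mkcondr.
have IN : mu.-integrable D (EFin \o (f \_ N)).
  apply: (le_integrable _ _ _ (integrableS measurableT mD (@subsetT _ D) If)) => //.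
    apply/measurable_EFinP; apply: measurable_funTS.
    by apply/(measurable_restrictT _ mN); exact: measurable_funTS.
  by move=> x _; rewrite /= lee_fin patchE; case: ifP => // _; rewrite normr0.
apply: le_Rintegral => //; first exact: integrableM.
move=> x Dx; have /andP[g0 g1] := g01 x Dx; rewrite patchE.
case: ifPn => [|h].
  by rewrite inE /N /= => fx; rewrite -[X in X <= _]mul1r ler_wnM2r// ltW.
by rewrite mulr_ge0// leNgt; apply: contra h => fx; rewrite inE.
Qed.

(** Bound m by 1 on B and by d outside; the part of d times the integral of f that lies over B is
    nonnegative and may be added. *)
Lemma localized_Rintegral_ge (m : R3 R -> R) (B : set (R3 R)) (d : R) :
  measurable B -> measurable_fun setT m -> (forall x, 0 <= m x <= 1) ->
  d <= 1 -> (forall x, ~ B x -> m x <= d) -> 0 <= d ->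
  \int[mu]_x (m x * f x) - d * \int[mu]_x f x <= \int[mu]_(x in B) f x.
Proof.
move=> mB mm m01 d1 md d0; have mC := measurableC mB.
have ID D : measurable D -> mu.-integrable D (EFin \o f).
  by move=> mD; exact: (integrableS measurableT mD (@subsetT _ D) If).
have split_ g : mu.-integrable setT (EFin \o g) ->
    \int[mu]_x g x = \int[mu]_(x in B) g x + \int[mu]_(x in ~` B) g x.
  move=> Ig; rewrite -[in LHS](setUv B) Rintegral_setU ?setUv//.
  by apply/disj_set2P; rewrite setICr.
have Imf D : measurable D -> mu.-integrable D (EFin \o (fun x => m x * f x)).
  by move=> mD; exact: integrableM.
rewrite (split_ _ (Imf _ measurableT)) (split_ _ If).
have h1 : \int[mu]_(x in B) (m x * f x) <= \int[mu]_(x in B) f x.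
  rewrite -subr_ge0 -RintegralB//; [|exact: ID|exact: Imf].
  have := @weighted_Rintegral_ge0 (fun x => 1 - m x) B mB.
  under eq_Rintegral do rewrite mulrBl mul1r.
  apply; first by apply: measurable_funB.
  by move=> x _; have /andP[? ?] := m01 x; apply/andP; split; lra.
have h2 : \int[mu]_(x in ~` B) (m x * f x) <= d * \int[mu]_(x in ~` B) f x.
  rewrite -RintegralZl//; last exact: ID.
  rewrite -subr_ge0 -RintegralB//; [|exact: (integrableZl mC d (ID _ mC))|exact:
    Imf].
  have := @weighted_Rintegral_ge0 (fun x => d - m x) (~` B) mC.
  under eq_Rintegral do rewrite mulrBl.
  apply; first by apply: measurable_funB.
  by move=> x Bx; have := md x Bx; have /andP[? ?] := m01 x; move=> ?;
    apply/andP; split; lra.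
have := f_ge0 mB; nra.
Qed.
End weighted_integrals.

Lemma measurable_euclidean_ball (a : R3 R) (r : R) : measurable (euclidean_ball a
  r).
Proof.
have -> : euclidean_ball a r = setT `&` (fun x : R3 R => dot (x - a) (x - a))
  @^-1` `]-oo, r ^+ 2[%classic.
  by rewrite setTI; apply/seteqP; split => x; rewrite /euclidean_ball /= in_itv.
have m : measurable_fun setT (fun x : R3 R => dot (x - a) (x - a)).
  by apply: measurable_dot; apply: measurable_subR3;
    [exact: measurable_id|exact: measurable_cst|exact: measurable_id|exact:
    measurable_cst].
exact: m.
Qed.

Lemma expabs3_le1 s a (x : R3 R) : 0 < s -> 0 <= expabs3 s a x <= 1.
Proof.
move=> s0; rewrite expabs3_ge0 /= /expabs3 -!expRD -expR0 ler_expR.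
by have := normr_ge0 (x.1.1 - a.1.1); have := normr_ge0 (x.1.2 - a.1.2);
  have := normr_ge0 (x.2 - a.2); nra.
Qed.

Lemma expabs3_outside s a r (x : R3 R) : 0 < s -> 0 < r -> ~ euclidean_ball a r x ->
  expabs3 s a x <= expR (- (s * r)).
Proof.
move=> s0 r0 /negP; rewrite /euclidean_ball /= dotE -leNgt /= => h.
rewrite /expabs3 -!expRD ler_expR.
have key (x1 x2 x3 : R) : r ^+ 2 <= x1 * x1 + x2 * x2 + x3 * x3 ->
    - (s * `|x1|) - s * `|x2| - s * `|x3| <= - (s * r).
  rewrite -!expr2 -(real_normK (num_real x1)) -(real_normK (num_real x2))
    -(real_normK (num_real x3)).
  move: (normr_ge0 x1) (normr_ge0 x2) (normr_ge0 x3).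
  move: `|x1| `|x2| `|x3| => u v w u0 v0 w0 h'.
  (* The l^1 norm dominates the Euclidean norm. *)
  suff : r <= u + v + w by nra.
  rewrite -ler_sqr ?nnegrE ?addr_ge0 ?(ltW r0)//.
  have := mulr_ge0 u0 v0; have := mulr_ge0 u0 w0; have := mulr_ge0 v0 w0; nra.
exact: key h.
Qed.
End localization.

(** * Wave packets on momentum cubes *)

Section wave_packet.
Local Open Scope complex_scope.
Variable R : realType.
Local Notation Re := (@complex.Re R).
Local Notation Im := (@complex.Im R).

Lemma expiD (x y : R) : expi (x + y) = expi x * expi y.
Proof. by rewrite /expi cosD sinD; congr (_ +i* _); ring. Qed.

Lemma conjc_scaled_expi (b x : R) : conjc (b%:C * expi x) = b%:C * expi (- x).
Proof. by rewrite /expi cosN sinN /=; congr (_ +i* _); ring. Qed.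

Lemma Re_scaled_expi (b t : R) (z : R[i]) :
  Re (b%:C * (z * expi t)) = b * (Re z * cos t - Im z * sin t).
Proof. by case: z => x y /=; ring. Qed.

Variables (c L : R) (v a : R3 R).
Hypotheses (c0 : 0 <= c) (L0 : 0 < L).

(** The phase translates the packet in position space: it replaces x by x - a in the density, so the
    ball may have any centre. *)
Definition wave_packet (p : R3 R) : R[i] := (box3 c v L p)%:C * expi (- dot a p).

Lemma box3_ge0 p : 0 <= box3 c v L p.
Proof. by rewrite /box3 !mulr_ge0 ?box_ge0. Qed.

Let box_idem (u t : R) : box u L t * box u L t = box u L t.
Proof. by rewrite /box indicE; case: (_ \in _); rewrite ?mulr1 ?mulr0. Qed.

Lemma sqmod_wave_packet p : sqmod wave_packet p = box3 (c ^+ 2) v L p.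
Proof.
rewrite /sqmod /wave_packet /expi /=.
rewrite (_ : _ + _ = box3 c v L p ^+ 2 * (cos (- dot a p) ^+ 2 + sin (- dot a p)
  ^+ 2)); last by ring.
rewrite cos2Dsin2 mulr1 /box3.
rewrite -[box v.1.1 L p.1.1 in RHS]box_idem -[box v.1.2 L p.1.2 in RHS]box_idem
  -[box v.2 L p.2 in RHS]box_idem.
by ring.
Qed.

Lemma normc_wave_packet p : Normc.normc (wave_packet p) = box3 c v L p.
Proof.
rewrite normc_sqmod sqmod_wave_packet -[RHS]ger0_norm ?box3_ge0// -sqrtr_sqr.
congr Num.sqrt; rewrite /box3.
rewrite -[box v.1.1 L p.1.1 in LHS]box_idem -[box v.1.2 L p.1.2 in LHS]box_idem
  -[box v.2 L p.2 in LHS]box_idem.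
by ring.
Qed.

Lemma measurable_wave_packet : Cmeasurable_fun setT wave_packet.
Proof.
have mb : measurable_fun setT (box3 c v L).
  by apply/measurable_EFinP; exact: measurable_int (integrable_box3 c v L).
have md : measurable_fun setT (fun p : R3 R => - dot a p).
  by apply: measurable_funN; apply: measurable_dot;
    [exact: measurable_cst|exact: measurable_id].
split.
  rewrite (_ : (fun _ => _) = (fun p => box3 c v L p * cos (- dot a p))).
    by apply: measurable_funM => //; exact: measurable_cos.
  by apply/funext => p; rewrite /wave_packet /expi /=; ring.
rewrite (_ : (fun _ => _) = (fun p => box3 c v L p * sin (- dot a p))).
  by apply: measurable_funM => //; exact: measurable_sin.
by apply/funext => p; rewrite /wave_packet /expi /=; ring.
Qed.

Lemma L2_wave_packet : L2 wave_packet.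
Proof.
apply/L2P; split; first exact: measurable_wave_packet.
have := integrable_box3 (c ^+ 2) v L.
by congr (_.-integrable _ _); apply/funext => p /=; rewrite sqmod_wave_packet.
Qed.

Lemma L1_wave_packet : Lp 1%:E wave_packet.
Proof.
split; first exact: measurable_wave_packet.
rewrite /finite_norm Lnorm1.
have /integrableP[_] := integrable_box3 c v L.
move=> h; rewrite (eq_integral (fun p => `|(EFin \o box3 c v L) p|)%E);
  first exact: h.
by move=> p _; congr (`| _%:E |)%E; exact: normc_wave_packet.
Qed.

Lemma nsq_wave_packet : nsq wave_packet = c ^+ 2 * (2 * L) ^+ 3.
Proof.
rewrite /nsq; under eq_Rintegral do rewrite sqmod_wave_packet.
have E := Rintegral_tensor3 (integrableZl measurableT (c ^+ 2) (integrable_box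
  v.1.1 L))
  (integrable_box v.1.2 L) (integrable_box v.2 L).
rewrite (RintegralZl _ measurableT (integrable_box _ _)) in E.
rewrite !Rintegral_box ?ltW// in E.
have -> : c ^+ 2 * (2 * L) ^+ 3 = c ^+ 2 * (2 * L) * (2 * L) * (2 * L) by ring.
by rewrite -E.
Qed.

Variable K : R3 R -> R3 R -> R[i].
Hypothesis supp : forall p, box3 c v L p != 0 -> p != 0.

(** Extension by zero, because K is controlled only away from the origin; for h = Re or Im this
    gives the total, bounded, measurable functions that [phase_density] takes. *)
Definition kernel_part (h : R[i] -> R) : R3 R * R3 R -> R :=
  (fun kp => h (K kp.1 kp.2)) \_ (punctured `*` punctured).

Lemma kernel_partE h k p : k != 0 -> p != 0 -> kernel_part h (k, p) = h (K k p).
Proof. by move=> k0 p0; rewrite /kernel_part patchE mem_set. Qed.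

(** The cube avoids the origin, so the integrals over the punctured space extend to the whole
    space. *)
Lemma Re_kernel_density x : Re (kernel_density K wave_packet x) =
  \int[mu3]_p \int[mu3]_k phase_density (kernel_part Re) (kernel_part Im) (box3 c
    v L) a p k x.
Proof.
rewrite /kernel_density {1}/Cint /=.
rewrite Rintegral_mkcond; apply: eq_Rintegral => p _; rewrite patchE.
case: ifPn => [|pP]; last first.
  have -> : (fun k => phase_density (kernel_part Re) (kernel_part Im) (box3 c v
    L) a p k x) = cst 0.
    apply/funext => k; rewrite /phase_density /=;
      suff -> : box3 c v L p = 0 by rewrite !mul0r.
    by apply/eqP; apply: contraNT pP => /supp p0; rewrite inE.
  by rewrite Rintegral_cst// mul0r.
rewrite inE /= => p0.
rewrite Rintegral_mkcond; apply: eq_Rintegral => k _; rewrite patchE.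
case: ifPn => [|kP]; last first.
  rewrite /phase_density /=; suff -> : box3 c v L k = 0 by rewrite mulr0 !mul0r.
  by apply/eqP; apply: contraNT kP => /supp k0; rewrite inE.
rewrite inE /= => k0.
rewrite /phase_density !kernel_partE// /wave_packet.
have -> : K k p * expi (dot (p - k) x) * conjc ((box3 c v L k)%:C * expi (- dot a
  k)) *
    ((box3 c v L p)%:C * expi (- dot a p)) =
    (box3 c v L p * box3 c v L k)%:C * (K k p * expi (dot (p - k) (x - a))).
  have -> : dot (p - k) (x - a) = dot (p - k) x + dot a k + - dot a p.
    by rewrite !dotE /=; ring.
  rewrite !expiD conjc_scaled_expi opprK (_ : forall x y : R, (x * y)%:C = x%:C *
    y%:C); last first.
    by move=> b b'; rewrite rmorphM.
  ring.
exact: Re_scaled_expi.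
Qed.
End wave_packet.

(** * States localized in a ball *)

Section separation.
Variables (R : realType) (T : set (R3 R) -> (R3 R -> R[i]) -> (R3 R -> R[i])).
Variable K : R3 R -> R3 R -> R[i].
Hypotheses (hT : POL T) (hK : kernel_of K T).
Hypothesis hii : {ae mu3, forall p : R3 R,
  K (lam.1 *: p) (lam.2 *: p)
    @[lam --> filter_prod (pinfty_nbhs R) (pinfty_nbhs R)]
    --> (1 : R[i]^o)}.
Local Notation Re := (@complex.Re R).
Local Notation Im := (@complex.Im R).

Lemma kernel_Re_near1 (e : R) : 0 < e -> exists2 eta : R, 0 < eta & exists2 N :
  R, 0 < N &
  forall k p : R3 R, N <= k.2 -> N <= p.2 ->
   `|k.1.1| <= eta * k.2 -> `|k.1.2| <= eta * k.2 ->
   `|p.1.1| <= eta * p.2 -> `|p.1.2| <= eta * p.2 -> 1 - e <= Re (K k p).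
Proof.
(* 2 - 2 Re K < 2 e amounts to Re K > 1 - e. *)
move=> e0; have s0 : 0 < Num.sqrt (2 * e) by rewrite sqrtr_gt0 mulr_gt0.
have [eta eta0 [N N0 h]] := kdist_cone_small (kernel_measurable hK)
  (kernel_separable hK)
  (kernel_rotation hK) (kernel_normalized hK) hii s0.
exists eta => //; exists N => // k p k1 p1 k2 k3 p2 p3.
have := h k p k1 p1 k2 k3 p2 p3; rewrite /kdist ltr_sqrt ?mulr_gt0//; lra.
Qed.

Lemma measurable_kernel_part (h : R[i] -> R) :
  measurable_fun (punctured `*` punctured) (fun kp : R3 R * R3 R => h (K kp.1
    kp.2)) ->
  measurable_fun setT (kernel_part K h).
Proof.
move=> mh; apply/(measurable_restrictT _ _).1 => //.
by apply: measurableX; exact: measurable_punctured.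
Qed.

Lemma kernel_part_le1 (h : R[i] -> R) :
  (forall k p, k != 0 -> p != 0 -> `|h (K k p)| <= 1) -> forall z, `|kernel_part
    K h z| <= 1.
Proof.
move=> h1 [k p]; rewrite /kernel_part patchE; case: ifPn => [|_];
  last by rewrite normr0.
by rewrite inE => -[/= k0 p0]; exact: h1.
Qed.

Let pi2 : R := (2 * pi) ^+ 3.
Let pi2_gt0 : 0 < pi2.
Proof. by rewrite exprn_gt0// mulr_gt0// pi_gt0. Qed.

Lemma Re_inner_kernel phi D : Lp 1%:E phi -> L2 phi -> measurable D ->
  mu3.-integrable D (EFin \o (fun x => Re (kernel_density K phi x))) /\
  \int[mu3]_(x in D) Re (kernel_density K phi x) = pi2 * Re (inner phi (T D phi)).
Proof.
move=> L1 L2p mD; have [[I _] ->] := kernel_represents hK L1 L2p mD; split => //.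
rewrite /Cint /= mul0r subr0 mulrA.
rewrite -[X in X * _](_ : 1 = _) ?mul1r// /pi2.
by rewrite mulfV// expf_neq0// mulf_neq0// gt_eqF// pi_gt0.
Qed.

(** Each coordinate contributes 2 L (2 pi) (1 - e)^2: one factor 1 - e from the shrunken interval,
    one from the arctangent. The factors 2 L are absorbed by the normalization of the packet. *)
Let cube_bound (c L e t : R) : 0 < e < 1 -> 0 < L -> c ^+ 2 * (2 * L) ^+ 3 = 1 ->
  (1 - e) * (pi / 2) <= t -> (1 - e) ^+ 6 * pi2 <= c ^+ 2 * (8 * (1 - e) * L * t)
    ^+ 3.
Proof.
move=> /andP[e0 e1] L0 c2 ht.
have -> : (1 - e) ^+ 6 * pi2 = c ^+ 2 * (2 * L) ^+ 3 * ((1 - e) ^+ 6 * pi2) by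
  rewrite c2 mul1r.
have -> : c ^+ 2 * (2 * L) ^+ 3 * ((1 - e) ^+ 6 * pi2) =
  c ^+ 2 * (8 * (1 - e) * L * ((1 - e) * (pi / 2))) ^+ 3 by rewrite /pi2; field.
apply: ler_wpM2l; first exact: sqr_ge0.
have A0 : 0 <= 8 * (1 - e) * L by apply: mulr_ge0; [lra|exact: ltW].
have B0 : 0 <= (1 - e) * (pi / 2) by apply: mulr_ge0;
  [lra|rewrite divr_ge0// pi_ge0].
by apply: lerXn2r; rewrite ?nnegrE; [exact: mulr_ge0|exact: mulr_ge0 A0 (le_trans
  B0 ht)|exact: ler_wpM2l].
Qed.

(** Of the seven factors 1 - e, six come from [cube_bound] and one from Re K >= 1 - e; the
    subtracted e bounds the weight outside the ball. *)
Lemma localized_state (a : R3 R) (r e : R) : 0 < r -> 0 < e < 1 ->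
  exists phi, [/\ L2 phi, nsq phi = 1 &
    (1 - e) ^+ 7 - e <= Re (inner phi (T (euclidean_ball a r) phi))].
Proof.
move=> r0 e01; have /andP[e0 e1] := e01.
have [s s0 sr] : exists2 s : R, 0 < s & expR (- (s * r)) <= e.
  exists (Num.max 1 (- ln e / r)); first by rewrite lt_max ltr01.
  rewrite -[X in _ <= X](lnK e0) ler_expR lerNl -ler_pdivrMr//.
  by rewrite le_max lexx orbT.
have [L L0 hL] : exists2 L : R, 0 < L & (1 - e) * (pi / 2) <= atan (e * L / s).
  have := @cvgy_atan R => /cvgrPdist_le /(_ (e * (pi / 2))).
  have pe : 0 < e * (pi / 2) by rewrite mulr_gt0// divr_gt0// pi_gt0.
  move=> /(_ pe) [M [_ hM]].
  pose y := `|M| + 1; have yM : M < y by rewrite (le_lt_trans (ler_norm _))// ltrDl.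
  have y0 : 0 < y by rewrite ltr_wpDl.
  exists (y * s / e); first by rewrite divr_gt0// mulr_gt0.
  have -> : e * (y * s / e) / s = y by field; rewrite !gt_eqF.
  by have := hM y yM; rewrite /= ler_norml => /andP[]; lra.
have [eta eta0 [N N0 hN]] := kernel_Re_near1 e0.
(* On the cube the third coordinate is at least N + L / eta, so the cube lies beyond N, and the
   other coordinates, at most L in absolute value, stay within the cone of slope [eta]. *)
pose v : R3 R := (0, 0, N + L / eta + L).
pose c := Num.sqrt (((2 * L) ^+ 3)^-1).
have c0 : 0 <= c by rewrite sqrtr_ge0.
have c2 : c ^+ 2 * (2 * L) ^+ 3 = 1.
  by rewrite sqr_sqrtr ?mulVf ?invr_ge0 ?exprn_ge0// ?mulr_ge0 ?ltW// gt_eqF//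
    exprn_gt0// mulr_gt0.
have supp p : box3 c v L p != 0 -> [/\ N <= p.2, `|p.1.1| <= eta * p.2 & `|p.1.2|
  <= eta * p.2].
  rewrite /box3 !mulf_eq0 !negb_or -!andbA => /and4P[_ /box_neq0 h1 /box_neq0 h2
    /box_neq0 h3].
  move: h1 h2 h3; rewrite /= !subr0 => h1 h2; rewrite ler_norml => /andP[h3 _].
  have Le : 0 < L / eta by rewrite divr_gt0.
  have h : L / eta <= p.2 by lra.
  have : L <= eta * p.2 by rewrite mulrC -ler_pdivrMr.
  by move=> h'; split; [lra|exact: le_trans h'|exact: le_trans h'].
have supp0 p : box3 c v L p != 0 -> p != 0.
  move=> /supp[Np _ _]; apply/negP => /eqP p0; move: Np; rewrite p0 /=.
  by rewrite leNgt N0.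
pose phi := wave_packet c L v a.
have P2 : L2 phi by exact: L2_wave_packet.
have P1 : Lp 1%:E phi by exact: L1_wave_packet.
have n1 : nsq phi = 1 by rewrite nsq_wave_packet.
exists phi; split => //.
pose f x := Re (kernel_density K phi x).
have mB := measurable_euclidean_ball a r.
have [If fT] := Re_inner_kernel P1 P2 measurableT.
have f0 D : measurable D -> 0 <= \int[mu3]_(x in D) f x.
  move=> mD; rewrite (Re_inner_kernel P1 P2 mD).2 mulr_ge0 ?(ltW pi2_gt0)//.
  by have := pol_positive hT mD P2; rewrite lecE => /andP[].
have fT1 : \int[mu3]_x f x = pi2.
  rewrite fT (inner_aeeq P2 (op_L2 (pol_bounded hT measurableT) P2) P2
    (pol_normalized hT P2)).
  by rewrite inner_self// n1 mulr1.
have := localized_Rintegral_ge If f0 mB (measurable_expabs3 s a) (fun x =>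
  expabs3_le1 a x s0)
  (ltW (le_lt_trans sr e1)) (fun x => expabs3_outside s0 r0) (expR_ge0 _).
rewrite (Re_inner_kernel P1 P2 mB).2 fT1.
set S := Re _ => hS.
have mr := measurable_kernel_part (kernel_measurable hK).1.
have mi := measurable_kernel_part (kernel_measurable hK).2.
have kr1 := kernel_part_le1 (kernel_Re_bound (kernel_separable hK)
  (kernel_normalized hK)).
have ki1 := kernel_part_le1 (kernel_Im_bound (kernel_separable hK)
  (kernel_normalized hK)).
have near1 p k : box3 c v L p != 0 -> box3 c v L k != 0 -> 1 - e <= kernel_part K
  Re (k, p).
  move=> hp hk; rewrite kernel_partE ?supp0//.
  by have [? ? ?] := supp _ hp; have [? ? ?] := supp _ hk; exact: hN.
have h1 := smeared_density_ge a mr mi kr1 ki1 (box3_ge0 L v c0) (integrable_box3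
  c v L) s0 near1.
have h2 := Rintegral_box3_poisson c v s0 L0 e01.
have h3 : \int[leb3 R]_x (expabs3 s a x * \int[leb3 R]_p \int[leb3 R]_k
    phase_density (kernel_part K Re) (kernel_part K Im) (box3 c v L) a p k x) =
    \int[mu3]_x (expabs3 s a x * f x).
  by apply: eq_Rintegral => x _; rewrite /f Re_kernel_density.
rewrite h3 in h1.
have h4 := cube_bound e01 L0 c2 hL.
have h5 : (1 - e) ^+ 7 * pi2 <= \int[mu3]_x (expabs3 s a x * f x).
  apply: le_trans h1; rewrite exprS -mulrA.
  apply: ler_wpM2l; first by rewrite subr_ge0 ltW.
  exact: le_trans h4 h2.
have h6 : expR (- (s * r)) * pi2 <= e * pi2 by rewrite ler_pM2r.
have {h3 h1 h2 near1} : pi2 * ((1 - e) ^+ 7 - e) <= pi2 * S by move: hS h5 h6;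
  clear; lra.
by rewrite ler_pM2l.
Qed.

Lemma separated_of_ray_limit : separated_POL T.
Proof.
move=> a r r0; have mB := measurable_euclidean_ball a r; have mC := measurableC mB.
apply: (opnorm_effect_eq1 (pol_bounded hT mB) (pol_positive hT mB) (pol_positive
  hT mC)).
  by move=> f Lf; exact: POL_setC.
(* Bernoulli's inequality gives (1 - d)^7 - d >= 1 - 8 d >= 1 - e; the bound 1 / 2 keeps d below
   1. *)
move=> e e0; pose d := Num.min (e / 8) (1 / 2).
have d01 : 0 < d < 1.
  by rewrite lt_min divr_gt0//= divr_gt0//= gt_min; apply/orP; right; lra.
have [phi [P2 n1 h]] := localized_state a r0 d01.
exists phi; split => //; apply: le_trans h.
have /andP[d0 d1] := d01.
have de : d <= e / 8 by rewrite ge_min lexx.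
suff : 1 - 7 * d <= (1 - d) ^+ 7 by lra.
have b n : 1 - n%:R * d <= (1 - d) ^+ n.
  elim: n => [|n IH]; first by rewrite mul0r subr0.
  rewrite exprS -natr1.
  have : (1 - d) * (1 - n%:R * d) <= (1 - d) * (1 - d) ^+ n by rewrite
    ler_wpM2l// subr_ge0 ltW.
  have : 0 <= n%:R * d * d :> R by apply: mulr_ge0; [apply: mulr_ge0|];
    rewrite ?ler0n// ltW.
  lra.
exact: b.
Qed.
End separation.

Unset Implicit Arguments.
Set Strict Implicit.

Theorem mainTheorem11 (R : realType)
    (T : set (R3 R) -> (R3 R -> R[i]) -> (R3 R -> R[i]))
    (K : R3 R -> R3 R -> R[i])
    (hT : POL T) (hK : kernel_of K T)
    (hi : forall k : R3 R, k != 0 ->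
      {ae mu3, forall p : R3 R, exists l : R[i],
        K k (lam *: p) @[lam --> +oo%R] --> (l : R[i]^o)})
    (hii : {ae mu3, forall p : R3 R,
      K (lam.1 *: p) (lam.2 *: p)
        @[lam --> filter_prod (pinfty_nbhs R) (pinfty_nbhs R)]
        --> (1 : R[i]^o)})
    (hiii : exists2 k0 : R3 R, k0 != 0 &
      forall lam : nat -> R, lam n @[n --> \oo] --> +oo%R ->
      ~ {ae mu3, forall p : R3 R,
          K k0 (lam n *: p) @[n --> \oo] --> (0 : R[i]^o)}) :
  separated_POL T.
Proof. exact: (separated_of_ray_limit hT hK hii). Qed.
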